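(* For every integer $n\ge 2$ and every bounded function $f\in C[0,1)$, $$\big\|\widetilde{M}_n f-f\big\| \le \big(\sqrt{6}+1\big)\,K\Big(f,\frac{1}{n^2}\Big).$$
   Context: $\|\cdot\|$ is the uniform norm on $[0,1)$ (essential supremum for functions defined only almost everywhere). Let $\varphi(x)=x(1-x)^2$ and $\widetilde{D}f(x)=\varphi(x)f''(x)$, $\widetilde{D}^2 f=\widetilde{D}(\widetilde{D}f)$; writing $\widetilde{D}h$ presupposes that $h,h'$ are locally absolutely continuous on $(0,1)$, so $\widetilde D h$ is defined a.e. For $n\in\mathbb{N}=\{1,2,\dots\}$, $k\ge 0$ and $x\in[0,1)$ let $P_{n,k}(x)=\binom{n+k}{k}x^k(1-x)^{n+1}$ and $\widetilde{P}_{n,k}(x)=P_{n,k}(x)-\frac1n\widetilde{D}P_{n,k}(x)$. For $f$ Lebesgue integrable on $(0,1)$ with finite limit $f(0)$ as $x\to0$ let $u_{n,0}(f)=f(0)$ and $u_{n,k}(f)=n\int_0^1P_{n,k-1}(t)(1-t)^{-2}f(t)\,dt$ for $k\ge1$. The operator is $$\widetilde{M}_n(f,x)=\sum_{k=0}^\infty u_{n,k}(f)\widetilde{P}_{n,k}(x),\qquad x\in[0,1).$$ $AC_{loc}(0,1)$ is the set of functions absolutely continuous on every $[a,b]\subset(0,1)$; $L_\infty[0,1)$ is the space of Lebesgue measurable essentially bounded functions on $[0,1)$. Let $W^2(\varphi)[0,1)=\{g: g,g'\in AC_{loc}(0,1),\ \widetilde{D}g\in L_\infty[0,1)\}$ (such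 $g$ have a finite limit at $0^+$, taken as $g(0)$), and let $W^2_0(\varphi)[0,1)$ be the subspace of those $g$ with $\lim_{x\to0^+}\widetilde{D}g(x)=0$. For $t>0$, $$K(f,t)=\inf\{\|f-g\|+t\|\widetilde{D}^2g\| : g\in W^2_0(\varphi)[0,1),\ \widetilde{D}g\in W^2(\varphi)[0,1)\}.$$ *)

(* Defs.v *)
From mathcomp Require Import all_boot all_order all_algebra.
From mathcomp Require Import all_classical all_reals all_analysis.

Set Implicit Arguments.
Unset Strict Implicit.
Unset Printing Implicit Defensive.

Import Order.TTheory GRing.Theory Num.Theory.
Import numFieldNormedType.Exports.

Local Open Scope classical_set_scope.
Local Open Scope ring_scope.

(* All functions are total functions R -> R, of which only the values on
   [0, 1[ matter. *)

Definition phi {R : realType} (x : R) : R := x * (1 - x) ^+ 2.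

(* The derivatives are the total ones of the library, whose value is 0 where
   the derivative does not exist. This makes [Dt h] a pointwise defined
   representative of the a.e. defined function phi h'' whenever h' is
   locally absolutely continuous. If that a.e. class contains a continuous
   function k, then h' is a primitive of k / phi, hence h'' exists and Dt h = k
   everywhere on ]0, 1[: no choice of representative is lost by asking
   regularity of [Dt h] itself. *)
Definition Dt {R : realType} (h : R -> R) (x : R) : R := phi x * derive1n 2 h x.

Definition Pnk {R : realType} (n k : nat) (x : R) : R :=
  'C(n + k, k)%:R * x ^+ k * (1 - x) ^+ n.+1.

Definition Ptnk {R : realType} (n k : nat) (x : R) : R :=
  Pnk n k x - n%:R^-1 * Dt (Pnk n k) x.

Definition unk {R : realType} (n k : nat) (f : R -> R) : R :=
  match k with
  | 0 => f 0
  | j.+1 =>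
      n%:R * \int[lebesgue_measure]_(t in `]0%R, 1%R[) (Pnk n j t * (1 - t) ^- 2 * f t)
  end.

Definition Mtn {R : realType} (n : nat) (f : R -> R) (x : R) : R :=
  limn (series (fun k => unk n k f * Ptnk n k x)).

Definition abs_continuous {R : realType} (a b : R) (h : R -> R) : Prop :=
  forall e : R, 0 < e -> exists2 d : R, 0 < d &
    forall (m : nat) (A B : 'I_m -> R),
      (forall i, a <= A i /\ A i <= B i /\ B i <= b) ->
      trivIset [set: 'I_m] (fun i => `]A i, B i[%classic) ->
      \sum_i (B i - A i) < d ->
      \sum_i `|h (B i) - h (A i)| < e.

Definition ACloc {R : realType} (h : R -> R) : Prop :=
  forall a b : R, 0 < a -> a <= b -> b < 1 -> abs_continuous a b h.

Definition unorm {R : realType} (h : R -> R) : \bar R :=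
  ereal_sup [set `|h x|%:E | x in `[0, 1[].

Definition enorm {R : realType} (h : R -> R) : \bar R :=
  'N[@lebesgue_measure R]_+oo [EFin \o (h \_ `[0, 1[)].

(* [lebesgue_measure] lives on Borel sets; this type carries the Lebesgue
   sigma-algebra, the domain of [completed_lebesgue_measure]. *)
Definition lebesgue_type (R : realType) :=
  caratheodory_type (wlength (@idfun R))^*%mu.

Definition Linfty {R : realType} (h : R -> R) : Prop :=
  measurable_fun (`[0, 1[ : set (lebesgue_type R)) (h : lebesgue_type R -> R) /\
  (enorm h < +oo)%E.

(* The last clause is the convention that g(0) is the limit of g at 0+, which
   always exists. It is consistent with the requirement [W2 (Dt g)] below, as
   [Dt g 0 = 0] and Dt g tends to 0 at 0+ for g in W20. *)
Definition W2 {R : realType} : set (R -> R) :=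
  [set g : R -> R | [/\ {in `]0, 1[, forall x : R, derivable g x 1},
               ACloc g, ACloc (derive1 g), Linfty (Dt g) &
               g x @[x --> 0^'+] --> g 0]].

Definition W20 {R : realType} : set (R -> R) :=
  [set g : R -> R | W2 g /\ Dt g x @[x --> 0^'+] --> (0 : R)].

Definition Kfun {R : realType} (f : R -> R) (t : R) : \bar R :=
  ereal_inf [set (unorm (f \- g)%R + t%:E * enorm (Dt (Dt g)))%E
            | g in [set g : R -> R | W20 g /\ W2 (Dt g)]].

(* Main.v *)
(* Let T_n be the operator with P_{n,k} in place of Pt_{n,k}, and D = Dt, so that
   Mt_n = T_n - D T_n / n.

   Norm: P_{n,k} = (n + k) (1 - x) / n * P_{n-1,k}, so Cauchy-Schwarz with the
   weight n + k bounds (sum_k |Pt_{n,k}|)^2 by (n + x) / n times a second moment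
   for the index n - 1, which is (3 n + 2) / n. The product is at most 6 for
   n >= 2 and x < 1, so that |Mt_n f| <= sqrt 6 |f|.

   Smooth functions: if h = D g, integration by parts gives D T_n g = T_n h and
   T_n g - T_{n+1} g = T_n h / (n (n + 1)). Telescoping over m >= n, with
   sum_m 1 / (m (m + 1)) = 1 / n, yields
     Mt_n g - g = sum_m (T_m h - T_n h) / (m (m + 1)),
   and the same identity for h bounds |T_m h - T_n h| by |D h| / n. The numbers
   u_{n,k}(D h) are never formed: they are read off h through the second
   difference [udelta], and bounded by |D h| because B Psi + h and B Psi - h are
   convex for B = |D h| and Psi = x ln(x / (1 - x)), a solution of D Psi = 1.

   As g' and h' are only absolutely continuous, their values are recovered from
   almost everywhere information by writing an absolutely continuous function as
   a difference of nondecreasing ones and applying Radon-Nikodym to the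
   associated Stieltjes measures. *)

From HB Require Import structures.
Require Import Defs.
From mathcomp Require Import all_boot all_order all_algebra.
From mathcomp Require Import all_classical all_reals all_analysis.
From mathcomp Require Import measurable_realfun ess_sup_inf ring lra.

Set Implicit Arguments.
Unset Strict Implicit.
Unset Printing Implicit Defensive.

Import Order.TTheory GRing.Theory Num.Theory.
Import numFieldNormedType.Exports.

Local Open Scope classical_set_scope.
Local Open Scope ring_scope.

(** * Absolutely continuous functions *)

Section AbsoluteContinuity.
Context {R : realType}.
Implicit Types (a b e : R) (F : R -> R).

(** The class in the infimum contains unbounded functions, such as [- ln (1 - x)], which D maps to
    [x]. Only those at finite distance from [f] matter, and they are bounded because [f] is. That
    bound yields the convergence of the series, the pointwise limit [T_m g -> g] which ends the
    telescoping, and, together with the bound on [h], the control of [x (1 - x) g'] at both ends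
    that removes the boundary terms of the integration by parts.

    The steps from [g] to [h] and from [h] to [D h] are treated differently because of regularity.
    As [h] is continuous, [g'] is differentiable everywhere and classical integration by parts
    applies. But [D h] is only essentially bounded: what is known of [h'] is that its increments are
    at most [B] times those of [Psi']. This is exactly the monotonicity of [B Psi' + h'] and
    [B Psi' - h'], which is all the convexity argument asks for.

    The condition [n >= 2] enters twice: in the constant 6, which is the value at [n = 2], [x = 1],
    and in the weight [(1 - t) ^+ n.-1] of [unk], whose exponent has to be positive to absorb the
    growth of [Psi] at 1. *)

Lemma abs_continuous_finType a b F : abs_continuous a b F ->
  forall e, 0 < e -> exists2 d, 0 < d &
    forall (T : finType) (A B : T -> R),
      (forall i, a <= A i /\ A i <= B i /\ B i <= b) ->
      trivIset [set: T] (fun i => `]A i, B i[%classic) ->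
      \sum_i (B i - A i) < d -> \sum_i `|F (B i) - F (A i)| < e.
Proof.
move=> acF e /acF[d d0 Fd]; exists d => // T A B AB tAB.
rewrite (reindex (@enum_val T predT)) /=; last first.
  by apply/onW_bij/enum_val_bij.
rewrite [in X in _ -> X](reindex (@enum_val T predT)) /=; last first.
  by apply/onW_bij/enum_val_bij.
apply: Fd => [i|i j _ _ /(tAB _ _ I I)]; first exact: AB.
exact: enum_val_inj.
Qed.

Lemma itv_partition_bounds a b (s : seq R) : itv_partition a b s ->
  forall i, (i < size s)%N ->
    [/\ a <= nth b (a :: s) i, nth b (a :: s) i <= nth b s i & nth b s i <= b].
Proof.
move=> abs i si; have ab := itv_partition_le abs.
case: (abs) => sa /eqP lb.
have ss : sorted <=%R (a :: s) by apply: (@sub_path _ <%R) sa => x y /ltW.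
have mono j k : (j <= k)%N -> (k <= size s)%N ->
    nth b (a :: s) j <= nth b (a :: s) k.
  move=> jk ks.
  apply: (sorted_leq_nth le_trans lexx _ ss) => //; rewrite inE /= ltnS //.
  exact: leq_trans ks.
split.
- by rewrite -[leLHS]/(nth b (a :: s) 0) mono// ltnW.
- by rewrite -[leRHS]/(nth b (a :: s) i.+1) mono.
- rewrite -{2}lb -nth_last -[nth b s i]/(nth b (a :: s) i.+1).
  rewrite (_ : nth _ s _ = nth b (a :: s) (size s)); first exact: mono.
  by case: s {abs sa lb ss mono} si => //= x s _; apply: set_nth_default.
Qed.

Lemma itv_partition_trivIset a b (s : seq R) : itv_partition a b s ->
  trivIset [set: 'I_(size s)]
    (fun i => `]nth b (a :: s) i, nth b s i[%classic).
Proof.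
move=> [sa /eqP lb].
have ss : sorted <=%R (a :: s) by apply: (@sub_path _ <%R) sa => x y /ltW.
suff lt (i j : 'I_(size s)) x : (i < j)%N ->
    `]nth b (a :: s) i, nth b s i[%classic x ->
    `]nth b (a :: s) j, nth b s j[%classic x -> False.
  move=> i j _ _ [x [xi xj]]; apply/val_inj => /=.
  by case: (ltngtP i j) => // ij; case: (lt _ _ _ ij xi xj) ||
     case: (lt _ _ _ ij xj xi).
move=> ij; rewrite /= !in_itv/= => /andP[_ xi] /andP[xj _].
have : nth b (a :: s) i.+1 <= nth b (a :: s) j.
  by apply: (sorted_leq_nth le_trans lexx _ ss) => //; rewrite inE /= ltnS // ltnW.
by rewrite leNgt (lt_trans xj xi).
Qed.

Lemma itv_partition_sum a b (s : seq R) : itv_partition a b s ->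
  \sum_(i < size s) (nth b s i - nth b (a :: s) i) = b - a.
Proof.
move=> [sa /eqP lb].
rewrite -(big_mkord xpredT (fun i => nth b s i - nth b (a :: s) i)).
rewrite (@telescope_sumr_eq _ _ _ (nth b (a :: s))) //=; congr (_ - _).
by rewrite -[size s]/(size (a :: s)).-1 nth_last.
Qed.

Lemma variation_ord a b F (s : seq R) :
  variation a b F s = \sum_(i < size s) `|F (nth b s i) - F (nth b (a :: s) i)|.
Proof. by rewrite /variation big_mkord. Qed.

Lemma abs_continuous_small_TV a b F : abs_continuous a b F ->
  exists2 d, 0 < d & forall x y, a <= x -> x <= y -> y <= b -> y - x < d ->
    bounded_variation x y F.
Proof.
move=> /abs_continuous_finType/(_ 1 ltr01)[d d0 Fd]; exists d => // x y ax xy yb xyd.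
exists 1 => _ [s xys] <-; rewrite variation_ord; apply/ltW/Fd.
- move=> i; have [xi ii iy] := itv_partition_bounds xys (ltn_ord i).
  by rewrite (le_trans ax xi) (le_trans iy yb).
- exact: itv_partition_trivIset.
- by rewrite itv_partition_sum.
Qed.

Lemma abs_continuous_BV a b F : a <= b -> abs_continuous a b F ->
  bounded_variation a b F.
Proof.
move=> ab /abs_continuous_small_TV[d d0 Fd].
(* Walk from [a] in steps of length [d / 2], each of finite variation; [k] counts the steps. *)
suff step k x : a <= x -> x <= b -> x - a <= (d / 2) *+ k -> bounded_variation a x F.
  have [k] : exists k : nat, (b - a) / (d / 2) <= k%:R.
    by exists (Num.bound ((b - a) / (d / 2))); rewrite ltW// archi_boundP// divr_ge0 ?subr_ge0// ltW// divr_gt0.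
  rewrite ler_pdivrMr ?divr_gt0// => abk; apply: (step k) => //.
  by rewrite -mulr_natl.
elim: k x => [|k IH] x ax xb.
  rewrite mulr0n subr_le0 => xa; have -> : x = a by apply/le_anti/andP.
  exact: bounded_variationxx.
move=> xk; pose y := Num.max a (x - d / 2).
have d20 : 0 < d / 2 by rewrite divr_gt0.
have ay : a <= y by rewrite le_max lexx.
have yx : y <= x by rewrite ge_max ax lerBlDr lerDl ltW.
have /bounded_variationP : bounded_variation a y F.
  apply: IH => //; first exact: le_trans yx xb.
  rewrite lerBlDr ge_max; apply/andP; split.
    by rewrite lerDr mulrn_wge0// ltW.
  by move: xk; rewrite mulrSr; lra.
move=> /(_ ay) fay.
have /bounded_variationP : bounded_variation y x F.
  apply: Fd => //; have : x - d / 2 <= y by rewrite le_max lexx orbT.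
  lra.
move=> /(_ yx) fyx.
by apply/bounded_variationP => //; rewrite (total_variationD F ay yx) fin_numD fay.
Qed.

(** The variation over each interval is nearly reached on some partition. The pieces of all these
    partitions form a single disjoint family with the same total length, to which the absolute
    continuity of [F] applies with [e / 2]; the other half of [e] pays for the approximation. *)
Lemma abs_continuous_total_variation a b F : a <= b -> abs_continuous a b F ->
  abs_continuous a b (fine \o total_variation a ^~ F).
Proof.
move=> ab acF; have bvF := abs_continuous_BV ab acF.
have bvs x y : a <= x -> x <= y -> y <= b -> bounded_variation x y F.
  move=> ax xy yb; apply: (bounded_variationl xy yb).
  by apply: (bounded_variationr ax _ bvF); exact: le_trans yb.
move=> e e0; have e20 : 0 < e / 2 by rewrite divr_gt0.
have [d d0 Fd] := abs_continuous_finType acF e20.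
exists d => // m A B AB tAB ABd.
have TVB i : fine (total_variation a (B i) F) - fine (total_variation a (A i) F) =
    fine (total_variation (A i) (B i) F).
  have [aA [AiB Bb]] := AB i.
  rewrite (total_variationD F aA AiB) fineD; first by rewrite addrAC subrr add0r.
    by apply/bounded_variationP => //; apply: bvs => //; exact: le_trans Bb.
  by apply/bounded_variationP => //; apply: bvs.
(* An error of [eta] on each of the [m] intervals; [m.+1] avoids a division by 0 when the family is
   empty. *)
pose eta := e / 2 / m.+1%:R.
have eta0 : 0 < eta by rewrite divr_gt0.
have /choice[s Hs] (i : 'I_m) : exists s, itv_partition (A i) (B i) s /\
    fine (total_variation (A i) (B i) F) - eta < variation (A i) (B i) F s.
  have [aA [AiB Bb]] := AB i.
  have fTV : total_variation (A i) (B i) F \is a fin_num.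
    by apply/bounded_variationP => //; exact: bvs.
  have [_ [_ [s Ps <-] <-]] := ub_ereal_sup_adherent eta0 fTV.
  by rewrite -/(total_variation _ _ _) -(fineK fTV) -EFinB lte_fin => ?; exists s.
rewrite (eq_bigr (fun i => fine (total_variation (A i) (B i) F))); last first.
  move=> i _; rewrite /= TVB ger0_norm// fine_ge0// total_variation_ge0//.
  by case: (AB i) => _ [].
(* Pairs of an interval and a piece of its partition; this index type is why absolute continuity is
   needed over arbitrary finite types. *)
pose T := {i : 'I_m & 'I_(size (s i))}.
pose A' (p : T) := nth (B (tag p)) (A (tag p) :: s (tag p)) (tagged p).
pose B' (p : T) := nth (B (tag p)) (s (tag p)) (tagged p).
have bnd (p : T) : [/\ A (tag p) <= A' p, A' p <= B' p & B' p <= B (tag p)].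
  exact: (itv_partition_bounds (Hs (tag p)).1 (ltn_ord (tagged p))).
have var_lt : \sum_p `|F (B' p) - F (A' p)| < e / 2.
  apply: Fd.
  - move=> p; have [aA [AiB Bb]] := AB (tag p); have [? ? ?] := bnd p.
    by split; [exact: le_trans aA _|split => //; exact: le_trans Bb].
  - move=> p q _ _ [x [xp xq]].
    have tpq : tag p = tag q.
      apply: (tAB _ _ I I); exists x; split.
        have [? _ ?] := bnd p; move: xp; apply: subset_itv; rewrite bnd_simp//.
      have [? _ ?] := bnd q; move: xq; apply: subset_itv; rewrite bnd_simp//.
    case: p q tpq xp xq => [i p] [j q] /= ij; subst j => xp xq.
    congr existT; apply: (itv_partition_trivIset (Hs i).1) => //.
    by exists x.
  - rewrite -(@sig_big_dep _ _ _ _ (fun i => 'I_(size (s i)) : finType) xpredT (fun _ => xpredT)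
       (fun i j => nth (B i) (s i) j - nth (B i) (A i :: s i) j)) /=.
    apply: le_lt_trans ABd; apply: ler_sum => i _.
    by rewrite itv_partition_sum//; case: (Hs i).
rewrite -(@sig_big_dep _ _ _ _ (fun i => 'I_(size (s i)) : finType) xpredT (fun _ => xpredT)
   (fun i j => `|F (nth (B i) (s i) j) - F (nth (B i) (A i :: s i) j)|)) /= in var_lt.
apply: (@le_lt_trans _ _ (\sum_(i < m) (variation (A i) (B i) F (s i) + eta))).
  by apply: ler_sum => i _; have [_] := Hs i; lra.
rewrite big_split /= sumr_const card_ord -mulr_natr [ltRHS]splitr.
rewrite (eq_bigr _ (fun i _ => variation_ord _ _ _ _)).
apply: ltr_leD => //; rewrite /eta -mulrA ger_pMr// mulrC ler_pdivrMr// mul1r.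
by rewrite ler_nat.
Qed.

End AbsoluteContinuity.

(** * Density of a monotone absolutely continuous function *)

Section MonotoneDensity.
Context {R : realType}.
Let mu : {measure set (measurableTypeR R) -> \bar R} := @lebesgue_measure R.

(** Cuts a component [I] of an open set down to [[a, b]]. The first inclusion keeps the lengths
    below the measure of the open set; the second bounds the Stieltjes mass of [I] by an increment
    of the function, and is half-open because Stieltjes measures are given on such intervals. *)
Lemma open_interval_clamp (I : set R) (a b : R) : a <= b ->
  open I -> is_interval I ->
  exists AB : R * R, [/\ a <= AB.1, AB.1 <= AB.2, AB.2 <= b,
    `]AB.1, AB.2[ `<=` I & I `&` `]a, b] `<=` `]AB.1, AB.2]].
Proof.
move=> ab oI iI; pose S := I `&` `[a, b].
have [S0|/nonemptyPn S0] := pselect (S !=set0); last first.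
  exists (a, a) => /=; split => //; first by rewrite set_itvoo0.
  move=> x [Ix /= xab]; have : S x by split => //=; apply: subset_itv_oc_cc xab.
  by rewrite S0.
have lS : has_lbound S by exists a => x [_] /=; rewrite in_itv/= => /andP[].
have uS : has_ubound S by exists b => x [_] /=; rewrite in_itv/= => /andP[].
have [s0 Ss0] := S0.
exists (inf S, sup S) => /=; split.
- by apply: lb_le_inf => // x [_] /=; rewrite in_itv/= => /andP[].
- by rewrite (le_trans (ge_inf lS Ss0))// ub_le_sup.
- by apply: ge_sup => // x [_] /=; rewrite in_itv/= => /andP[].
- move=> x /=; rewrite in_itv/= => /andP[/(inf_lt S0)[y [Iy _] yx]].
  move=> /(sup_gt S0)[z [Iz _] xz].
  by apply: (iI y z) => //; rewrite !ltW.
- move=> x [Ix /=]; rewrite !in_itv/= => /andP[ax xb].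
  have Sx : S x by split => //=; rewrite in_itv/= xb ltW.
  rewrite ub_le_sup// andbT.
  have /nbhs_ballP[e /= e0 xe] : nbhs x I by exact: open_nbhs_nbhs.
  (* As [I] is open and [a < x], there is a point of [S] strictly to the left of [x], so that
     [inf S < x]. *)
  pose y := Num.max a (x - e / 2).
  have yx : y < x by rewrite gt_max ax/= ltrBlDr ltrDl divr_gt0.
  have yab : y \in `[a, b] by rewrite in_itv/= le_max lexx/= (le_trans (ltW yx)).
  apply: (le_lt_trans _ yx); apply: ge_inf => //; split.
    apply: xe; rewrite /ball/= ger0_norm ?subr_ge0 1?ltW//.
    by rewrite ltrBlDr -ltrBlDl lt_max; apply/orP; right; lra.
  exact: yab.
Qed.

Variables (a b : R) (N : R -> R).
Hypotheses (ab : a < b) (ndN : {in `[a, b] &, nondecreasing_fun N}).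
Hypothesis acN : abs_continuous a b N.

(** A cumulative function lives on the whole line: composing with [c] extends [N] by constants
    outside [[a, b]]. *)
Let c (x : R) := Num.max a (Num.min b x).
Let Nc := N \o c.

Let cab x : c x \in `[a, b].
Proof. by rewrite in_itv/= /c le_max lexx/= ge_max ltW//= ge_min lexx. Qed.

Let cE x : x \in `[a, b] -> c x = x.
Proof.
by rewrite in_itv/= => /andP[ax xb]; rewrite /c min_r// max_r.
Qed.

Let c_nd x y : x <= y -> c x <= c y.
Proof.
move=> xy; rewrite /c ge_max !le_max lexx/=; apply/orP; right.
by rewrite le_min !ge_min lexx xy/= orbT.
Qed.

Let Nc_nd : nondecreasing Nc.
Proof. by move=> x y xy; apply: ndN => //; exact: c_nd. Qed.

Let c_lip x y : x <= y -> c y - c x <= y - x.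
Proof.
move=> xy; rewrite /c.
case: (lerP b x) => ?; case: (lerP b y) => ?; case: (lerP a b) => ?;
  case: (lerP a x) => ?; case: (lerP a y) => ?; lra.
Qed.

Let Nc_cont : continuous Nc.
Proof.
move=> x; apply/cvgrPdist_lt => e e0.
have [d d0 Fd] := abs_continuous_finType acN e0.
have key y z : y <= z -> z - y < d -> `|Nc z - Nc y| < e.
  move=> yz yzd.
  have := Fd unit (fun=> c y) (fun=> c z).
  rewrite !big_const !cardT enumT unlock /= !addr0; apply.
  - have := cab y; have := cab z; rewrite !in_itv/= => /andP[? ?] /andP[? ?].
    by move=> _; do 2 split => //; exact: c_nd.
  - by move=> [] [].
  - exact: le_lt_trans (c_lip yz) yzd.
near=> y; have xyd : `|x - y| < d by near: y; apply/nbhs_ballP; exists d.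
have [xy|/ltW yx] := leP x y.
  by rewrite distrC; apply: key => //; rewrite -(ger0_norm (_ : 0 <= y - x)) ?subr_ge0// distrC.
by apply: key => //; rewrite -(ger0_norm (_ : 0 <= x - y)) ?subr_ge0.
Unshelve. all: by end_near. Qed.

Let Nc_rc : right_continuous Nc.
Proof. exact: right_continuousW. Qed.

Let cumN := HB.pack_for (cumulative R R) Nc (isCumulative.Build R _ R Nc Nc_nd Nc_rc).

Let nu : {measure set (measurableTypeR R) -> \bar R} :=
  lebesgue_stieltjes_measure cumN.

Let nu_itv x y : x <= y -> nu `]x, y]%classic = (Nc y - Nc x)%:E.
Proof.
move=> xy; rewrite /nu/= /lebesgue_stieltjes_measure /measure_extension.
by rewrite measurable_mu_extE/=; [rewrite wlength_itv_bnd|exact: is_ocitv].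
Qed.

Let mab : measurable (`]a, b]%classic : set (measurableTypeR R)).
Proof. exact: measurable_itv. Qed.

Let nuab : (nu `]a, b]%classic < +oo)%E.
Proof. by rewrite nu_itv ?ltry// ltW. Qed.

Let nu' : {finite_measure set (measurableTypeR R) -> \bar R} := mfrestr mab nuab.

(** By outer regularity a null set lies in an open set of measure less than the [d] given by
    absolute continuity for [e]. The components of that set, clamped to [[a, b]], are disjoint of
    total length less than [d], so each partial sum of their masses is less than [e]. *)
Let nu'_dom (A : set (measurableTypeR R)) : measurable A -> mu A = 0%E ->
  forall e, 0 < e -> (nu' A <= e%:E)%E.
Proof.
move=> mA A0 e e0; have [d d0 Fd] := acN e0.
have [|U [oU AU UAd]] := lebesgue_regularity_outer mA _ d0.
  by rewrite -/mu A0.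
have mU : measurable (U : set (measurableTypeR R)) by exact: open_measurable.
have {UAd} Ud : (mu U < d%:E)%E.
  apply: le_lt_trans UAd; rewrite -[X in (mu X <= _)%E](setDUK AU).
  apply: (le_trans (measureU2 _ mA (measurableD mU mA))).
  by rewrite [X in (X + _ <= _)%E]A0 add0e.
pose I := open_disjoint_itv oU.
have mI k : measurable (I k : set (measurableTypeR R)).
  by apply: open_measurable; exact: open_disjoint_itv_open.
have tI : trivIset setT I by exact: open_disjoint_itv_trivIset.
have UI : U = \bigcup_k I k by exact: open_disjoint_itv_bigcup.
have /choice[AB HAB] k := open_interval_clamp (ltW ab)
  (@open_disjoint_itv_open _ _ oU k) (@open_disjoint_itv_is_interval _ _ oU k).
apply: (@le_trans _ _ (nu' U)); first by rewrite le_measure ?inE.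
rewrite [in X in (nu' X <= _)%E]UI measure_semi_bigcup//; last exact: bigcup_measurable.
apply: lime_le; first exact: is_cvg_nneseries.
near=> n; rewrite big_mkord.
apply: (@le_trans _ _ (\sum_(i < n) (N (AB i).2 - N (AB i).1)%:E)%E).
  apply: lee_sum => i _; have [aA AiB Bb _ sub] := HAB i.
  rewrite /nu'/= /mfrestr /mrestr.
  apply: (@le_trans _ _ (nu `](AB i).1, (AB i).2]%classic)).
    by rewrite le_measure ?inE//; apply: measurableI => //; exact: mI.
  have A1 : (AB i).1 \in `[a, b] by rewrite in_itv/= aA (le_trans AiB).
  have A2 : (AB i).2 \in `[a, b] by rewrite in_itv/= Bb (le_trans aA).
  by rewrite nu_itv//= /Nc/= !cE.
rewrite sumEFin lee_fin; apply/ltW.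
have {}Fd := Fd n (fun i => (AB i).1) (fun i => (AB i).2).
apply: le_lt_trans (Fd _ _ _).
- by apply: ler_sum => i _; rewrite ler_norm.
- by move=> i; have [aA AiB Bb _ sub] := HAB i.
- move=> i j _ _ [x [xi xj]]; apply/val_inj/tI => //; exists x.
  by split; [have [_ _ _ + _] := HAB i|have [_ _ _ + _] := HAB j]; exact.
- rewrite -lte_fin -sumEFin; apply: le_lt_trans Ud.
  rewrite (eq_bigr (fun i : 'I_n => mu `](AB i).1, (AB i).2[%classic)); last first.
    move=> i _; have [_ AiB _ _ _] := HAB i.
    rewrite /mu/= lebesgue_measure_itv/= lte_fin; case: ltP => //.
    by move=> BA; rewrite (le_anti (introT andP (conj AiB BA))) subrr.
  rewrite -measure_bigsetU_ord//.
    apply: le_measure; rewrite ?inE//; first exact: bigsetU_measurable.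
    rewrite -(bigcup_mkord n (fun i => `](AB i).1, (AB i).2[%classic)) UI => x [i _ xi]; exists i => //.
    by have [_ _ _ + _] := HAB i; exact.
  move=> i j _ _ [x [xi xj]]; apply/val_inj/tI => //; exists x.
  by split; [have [_ _ _ + _] := HAB i|have [_ _ _ + _] := HAB j]; exact.
Unshelve. all: by end_near. Qed.

Lemma nondecreasing_abs_continuous_density :
  exists2 d : R -> R, mu.-integrable setT (EFin \o d) &
    forall x, x \in `[a, b] -> N x - N a = (\int[mu]_(t in `[a, x]) d t)%R.
Proof.
have dom : nu' `<< mu.
  move=> B B0 A mA /(B0 _ mA) A0; apply/eqP; rewrite eq_le measure_ge0 andbT.
  by apply/lee_addgt0Pr => e e0; rewrite add0e; exact: nu'_dom.
have [f [f0 ff fi fE]] := radon_nikodym_sigma_finite dom.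
have Ef : EFin \o (fine \o f) = f by apply/funext => x /=; rewrite fineK.
exists (fine \o f); first by rewrite Ef.
move=> x xab; have /andP[ax xb] : a <= x <= b by move: xab; rewrite in_itv.
rewrite -Rintegral_itv_obnd_cbnd; last first.
  by rewrite Ef; apply: integrableS fi.
rewrite /Rintegral (eq_integral f); last by move=> t _ /=; rewrite fineK.
rewrite -fE; last exact: measurable_itv.
rewrite /nu'/= /mfrestr /mrestr setIidl; last by apply: subset_itv; rewrite bnd_simp.
by rewrite nu_itv//= /Nc/= !cE// in_itv/= lexx ltW.
Qed.

End MonotoneDensity.

(** * Fundamental theorem of calculus for absolutely continuous functions *)

Section AbsContinuousFTC.
Context {R : realType}.
Let mu : {measure set (measurableTypeR R) -> \bar R} := @lebesgue_measure R.

Lemma abs_continuousD (a b : R) (F G : R -> R) :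
  abs_continuous a b F -> abs_continuous a b G -> abs_continuous a b (F \+ G).
Proof.
move=> acF acG e e0; have e20 : 0 < e / 2 by rewrite divr_gt0.
have [d d0 Fd] := acF _ e20; have [d' d'0 Gd] := acG _ e20.
exists (Num.min d d'); first by rewrite lt_min d0.
move=> m A B AB tAB; rewrite lt_min => /andP[ABd ABd'].
rewrite [ltRHS]splitr; apply: le_lt_trans (ltrD (Fd m A B _ _ _) (Gd m A B _ _ _)) => //.
rewrite -big_split/=; apply: ler_sum => i _.
by rewrite opprD addrACA ler_normD.
Qed.

Lemma derivable_near_addC (F G : R -> R) (c x : R) :
  (\forall y \near x, F y = c + G y) -> derivable G x 1 ->
  derivable F x 1 /\ derive1 F x = derive1 G x.
Proof.
move=> nFG dG.
have [dF EF] : is_derive x 1 F (0 + 'D_1 G x).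
  apply: (@near_eq_is_derive _ _ _ (cst c \+ G)); first by apply: filterS nFG.
  by apply: is_deriveD; exact: DeriveDef.
by split => //; rewrite !derive1E EF add0r.
Qed.

(** The monotone decomposition is [F = (V + F) - V] with [V] the total variation from [a]; [V + F]
    is nondecreasing because [|F y - F x| <= V y - V x]. The derivative is then found almost
    everywhere by Lebesgue differentiation of the primitive of the density. *)
Lemma abs_continuous_FTC (a b : R) (F : R -> R) : a < b -> abs_continuous a b F ->
  exists d : R -> R, [/\ mu.-integrable setT (EFin \o d),
    forall x, x \in `[a, b] -> F x - F a = (\int[mu]_(t in `[a, x]) d t)%R &
    {ae mu, forall x, x \in `]a, b[ -> derivable F x 1 /\ derive1 F x = d x}].
Proof.
move=> ab acF; have bvF := abs_continuous_BV (ltW ab) acF.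
have acV := abs_continuous_total_variation (ltW ab) acF.
set V := fine \o _ in acV.
have VB x y : a <= x -> x <= y -> y <= b -> `|F y - F x| <= V y - V x.
  move=> ax xy yb.
  have f1 : total_variation a x F \is a fin_num.
    by apply/bounded_variationP => //; apply: bounded_variationl bvF => //; exact: le_trans yb.
  have f2 : total_variation x y F \is a fin_num.
    apply/bounded_variationP => //; apply: (bounded_variationl xy yb).
    by apply: bounded_variationr bvF => //; exact: le_trans yb.
  rewrite /V/= (total_variationD F ax xy) fineD// addrAC subrr add0r -lee_fin fineK//.
  exact: total_variation_ge.
have ndV : {in `[a, b] &, nondecreasing_fun V}.
  move=> x y; rewrite !in_itv/= => /andP[ax _] /andP[_ yb] xy.
  by rewrite -subr_ge0 (le_trans _ (VB _ _ ax xy yb)).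
have ndVF : {in `[a, b] &, nondecreasing_fun (V \+ F)}.
  move=> x y; rewrite !in_itv/= => /andP[ax _] /andP[_ yb] xy.
  have := VB _ _ ax xy yb; rewrite ler_norml => /andP[]; lra.
have [d1 id1 Hd1] := nondecreasing_abs_continuous_density ab ndVF (abs_continuousD acV acF).
have [d2 id2 Hd2] := nondecreasing_abs_continuous_density ab ndV acV.
have id : mu.-integrable setT (EFin \o (d1 \- d2)).
  by rewrite (_ : _ \o _ = (EFin \o d1) \- (EFin \o d2))%E; [exact: integrableB|].
have FE x : x \in `[a, b] -> F x - F a = (\int[mu]_(t in `[a, x]) (d1 \- d2) t)%R.
  move=> xab; rewrite RintegralB//; try exact: (integrableS measurableT).
  by rewrite -Hd1// -Hd2//=; ring.
exists (d1 \- d2); split => //.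
have idb y : mu.-integrable [set` Interval (BLeft a) (BRight y)] (EFin \o (d1 \- d2)).
  exact: (integrableS measurableT).
have /= := FTC1 idb (open_integrable_locally openT id).
apply: filterS; first exact: (ae_filter_ringOfSetsType mu).
move=> x; rewrite in_itv/= => + /andP[ax xb] => /(_ ax).
set G := (G in derivable G x 1) => -[dG <-].
have nFG : \forall y \near x, F y = F a + G y.
  have : x \in `]a, b[ by rewrite in_itv/= ax.
  move=> /near_in_itvoo; apply: filterS => y yab.
  have <- : F y - F a = G y by apply: FE; exact: subset_itv_oo_cc yab.
  by rewrite subrKC.
exact: (derivable_near_addC nFG dG).
Qed.

End AbsContinuousFTC.

(** * The negative binomial basis *)

Section NegativeBinomial.
Context {R : realType}.
Implicit Types (x : R) (n k : nat).

Lemma Pnk_ge0 n k x : 0 <= x -> x < 1 -> 0 <= Pnk n k x.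
Proof.
by move=> x0 x1; rewrite /Pnk !mulr_ge0 ?exprn_ge0// subr_ge0 ltW.
Qed.

Lemma Pnk_pascal n k x :
  Pnk n.+1 k.+1 x = (1 - x) * Pnk n k.+1 x + x * Pnk n.+1 k x.
Proof.
rewrite /Pnk addSn binS natrD addSnnS !exprS.
by ring.
Qed.

Lemma series_Pnk_rec n N x :
  (1 - x) * series (Pnk n.+1 ^~ x) N.+1 =
  (1 - x) * series (Pnk n ^~ x) N.+1 - x * Pnk n.+1 N x.
Proof.
elim: N => [|N IH].
  rewrite /series/= !big_nat1 /Pnk !addn0 !bin0 !expr0 !exprS; ring.
have S m M : series (Pnk m ^~ x) M.+1 = series (Pnk m ^~ x) M + Pnk m M x.
  by rewrite /series/= big_nat_recr.
rewrite S mulrDr IH (S n N.+1) Pnk_pascal; ring.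
Qed.

Lemma series_Pnk0 N x : series (Pnk 0 ^~ x) N = 1 - x ^+ N.
Proof.
elim: N => [|N IH]; first by rewrite /series/= big_nil expr0 subrr.
rewrite [LHS](_ : _ = series (Pnk 0 ^~ x) N + Pnk 0 N x).
  by rewrite IH /Pnk add0n binn !exprS expr0; ring.
by rewrite /series/= big_nat_recr.
Qed.

(** Induction on [n] from the geometric series. The partial sums are increasing and at most 1, hence
    converge, so the last term of [series_Pnk_rec] tends to 0 and the recursion says that two
    consecutive indices have the same sum. *)
Lemma Pnk_sum n x : 0 <= x -> x < 1 -> series (Pnk n ^~ x) @ \oo --> (1 : R).
Proof.
move=> x0 x1; have y0 : 0 < 1 - x by rewrite subr_gt0.
have nd m : nondecreasing_seq (series (Pnk m ^~ x)).
  by apply: nondecreasing_series => k _ _; exact: Pnk_ge0.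
have le1 m N : series (Pnk m ^~ x) N <= 1.
  elim: m N => [|m IH] [|N]; rewrite ?series_Pnk0 ?gerBl ?exprn_ge0//.
    by rewrite /series/= big_nil.
  rewrite -(ler_pM2l y0) series_Pnk_rec mulr1.
  rewrite lerBlDr (le_trans (_ : _ <= (1 - x) * 1)) ?ler_pM2l// mulr1 lerDl.
  by rewrite mulr_ge0// Pnk_ge0.
have cv m : cvgn (series (Pnk m ^~ x)).
  by apply: nondecreasing_is_cvgn => //; exists 1 => _ [N _ <-].
elim: n => [|n IH].
  rewrite (_ : series _ = fun N => 1 - x ^+ N); last first.
    by apply/funext => N; exact: series_Pnk0.
  have : 1 - x ^+ N @[N --> \oo] --> (1 - 0 : R).
    by apply: cvgB; [exact: cvg_cst|apply: cvg_expr; rewrite ger0_norm].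
  by rewrite subr0.
have P0 : Pnk n.+1 ^~ x @ \oo --> (0 : R) by exact: cvg_series_cvg_0.
rewrite -cvg_shiftS.
rewrite (_ : (fun N => _) = fun N => series (Pnk n ^~ x) N.+1 - x / (1 - x) * Pnk n.+1 N x); last first.
  apply/funext => N; apply: (mulfI (lt0r_neq0 y0)); rewrite series_Pnk_rec.
  by field; rewrite lt0r_neq0.
have : series (Pnk n ^~ x) N.+1 - x / (1 - x) * Pnk n.+1 N x @[N --> \oo] -->
    (1 - x / (1 - x) * 0 : R).
  apply: cvgB; first by rewrite (cvg_shiftS (series (Pnk n ^~ x))).
  by apply: cvgM => //; exact: cvg_cst.
by rewrite mulr0 subr0.
Qed.

Lemma PnkS n k x :
  k.+1%:R * (1 - x) * Pnk n k.+1 x = n.+1%:R * x * Pnk n.+1 k x.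
Proof.
have : (k.+1%:R * 'C(n + k.+1, k.+1)%:R = n.+1%:R * 'C(n.+1 + k, k)%:R :> R).
  rewrite -!natrM; congr (_%:R).
  by rewrite mul_bin_left addnS -addSn addnK.
rewrite /Pnk !exprS => E.
transitivity (k.+1%:R * 'C(n + k.+1, k.+1)%:R * (x * x ^+ k * ((1 - x) * (1 - x) * (1 - x) ^+ n))); first by ring.
by rewrite E; ring.
Qed.

(** By [PnkS], each factor of the falling factorial is traded for a factor [x / (1 - x)], lowering
    [k] by one and raising [n] by one. *)
Lemma Pnk_ffact_sum j n x : 0 <= x -> x < 1 ->
  series (fun k => (k ^_ j)%:R * Pnk n k x) @ \oo -->
  ((n + j) ^_ j)%:R * (x / (1 - x)) ^+ j.
Proof.
move=> x0 x1; have y0 : 1 - x != 0 by rewrite subr_eq0 gt_eqF.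
elim: j n => [|j IH] n.
  rewrite ffactn0 expr0 mulr1.
  rewrite (_ : (fun k => _) = Pnk n ^~ x); first exact: Pnk_sum.
  by apply/funext => k; rewrite ffactn0 mul1r.
rewrite -cvg_shiftS.
rewrite (_ : (fun N => _) = fun N => n.+1%:R * (x / (1 - x)) *
    series (fun k => (k ^_ j)%:R * Pnk n.+1 k x) N); last first.
  apply/funext => N; rewrite /series/= big_nat_recl//= ffact0n mul0r add0r.
  rewrite mulr_sumr; apply: eq_bigr => k _.
  rewrite ffactSS natrM; apply: (mulfI y0).
  transitivity ((k ^_ j)%:R * (k.+1%:R * (1 - x) * Pnk n k.+1 x)); first by ring.
  by rewrite PnkS; field.
rewrite addnS -addSn ffactnSr addnK natrM exprS.
rewrite (_ : _ * _ * (_ * _) = n.+1%:R * (x / (1 - x)) * (((n.+1 + j) ^_ j)%:R * (x / (1 - x)) ^+ j)); last by ring.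
by apply: cvgM; [exact: cvg_cst|exact: IH].
Qed.

Lemma ffact_natr k j : (k ^_ j.+1)%:R = (k ^_ j)%:R * (k%:R - j%:R) :> R.
Proof.
rewrite ffactnSr natrM; have [jk|kj] := leqP j k; first by rewrite natrB.
by rewrite ffact_small// !mul0r.
Qed.

Lemma cvg_toE (T : Type) (F : set_system T) (u : T -> R) (a b : R) :
  u @ F --> a -> a = b -> u @ F --> b.
Proof. by move=> + <-. Qed.

Lemma cvg_series_lin (u v : nat -> R) (a b c d : R) :
  series u @ \oo --> a -> series v @ \oo --> b ->
  series (fun k => c * u k + d * v k) @ \oo --> c * a + d * b.
Proof.
move=> ua vb.
rewrite (_ : series _ = fun N => c * series u N + d * series v N); last first.
  by apply/funext => N; rewrite /series/= big_split/= !mulr_sumr.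
by apply: cvgD; apply: cvgM => //; exact: cvg_cst.
Qed.

Arguments cvg_series_lin {u v a b} c d.

(** Degree 4 is what the square of a quadratic polynomial in [k] requires, in [Pnk_second_moment].
    The other moments are obtained from the same formula. *)
Lemma Pnk_quartic_sum n x (c0 c1 c2 c3 c4 : R) : 0 <= x -> x < 1 ->
  let y := x / (1 - x) in let r : R := n.+1%:R in
  series (fun k => let t : R := k%:R in
    (c0 + c1 * t + c2 * (t * (t - 1)) + c3 * (t * (t - 1) * (t - 2))
     + c4 * (t * (t - 1) * (t - 2) * (t - 3))) * Pnk n k x) @ \oo -->
  c0 + c1 * (r * y) + c2 * (r * (r + 1) * y ^+ 2)
     + c3 * (r * (r + 1) * (r + 2) * y ^+ 3)
     + c4 * (r * (r + 1) * (r + 2) * (r + 3) * y ^+ 4).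
Proof.
move=> x0 x1 y r.
have H j := @Pnk_ffact_sum j n x x0 x1.
have HH := cvg_series_lin 1 c4 (cvg_series_lin 1 c3 (cvg_series_lin 1 c2
  (cvg_series_lin c0 c1 (H 0) (H 1)) (H 2)) (H 3)) (H 4).
rewrite (_ : (fun k => _) = (fun k => 1 * (1 * (1 * (c0 * ((k ^_ 0)%:R * Pnk n k x)
    + c1 * ((k ^_ 1)%:R * Pnk n k x)) + c2 * ((k ^_ 2)%:R * Pnk n k x))
    + c3 * ((k ^_ 3)%:R * Pnk n k x)) + c4 * ((k ^_ 4)%:R * Pnk n k x))); last first.
  by apply/funext => k; rewrite !ffact_natr ffactn0 /=; ring.
apply: (cvg_toE HH); rewrite !ffact_natr !ffactn0 -/y /r !natrD -!natr1; ring.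
Qed.

End NegativeBinomial.

(** * The operator D on the basis functions *)

Section DtPnk.
Context {R : realType}.
Implicit Types (x : R) (n k : nat).

Lemma is_derive_monomial i j x :
  is_derive x 1 (fun t : R => t ^+ i * (1 - t) ^+ j)
    (i%:R * x ^+ i.-1 * (1 - x) ^+ j - j%:R * (x ^+ i * (1 - x) ^+ j.-1)).
Proof.
have d1 : is_derive x 1 (fun t : R => 1 - t) (0 - 1).
  exact: is_deriveB.
have di := @is_deriveX R R id i x 1 1 (is_derive_id (x : R^o) (1 : R^o)).
have dj := @is_deriveX R R (fun t : R => 1 - t) j x 1 _ d1.
have := is_deriveM di dj; rewrite !exprfctE => H.
apply: is_derive_eq H _.
rewrite /GRing.scale/= !mulr_natl; ring.
Qed.

Lemma is_derive_Pnk n k x : is_derive x 1 (Pnk n k)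
  ('C(n + k, k)%:R * (k%:R * (x ^+ k.-1 * (1 - x) ^+ n.+1))
   - 'C(n + k, k)%:R * (n.+1%:R * (x ^+ k * (1 - x) ^+ n))).
Proof.
have -> : Pnk n k = (fun t : R => 'C(n + k, k)%:R *: (t ^+ k * (1 - t) ^+ n.+1)).
  by apply/funext => t; rewrite /Pnk /GRing.scale/= mulrA.
have := @is_deriveZ R R R _ 'C(n + k, k)%:R _ _ _ (is_derive_monomial k n.+1 x).
move=> H; apply: is_derive_eq H _.
by rewrite /GRing.scale/=; ring.
Qed.

(** The truncated exponents [k.-1], [k.-2] and [n.-1] are harmless: whenever one is wrong, its
    coefficient is 0. *)
Lemma Dt_Pnk n k x : Dt (Pnk n k) x = phi x * ('C(n + k, k)%:R *
  (k%:R * (k.-1%:R * (x ^+ k.-2 * (1 - x) ^+ n.+1))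
   - 2 * (k%:R * n.+1%:R * (x ^+ k.-1 * (1 - x) ^+ n))
   + n.+1%:R * n%:R * (x ^+ k * (1 - x) ^+ n.-1))).
Proof.
rewrite /Dt; congr (_ * _); rewrite /derive1n /= .
set c : R := 'C(n + k, k)%:R.
have -> : derive1 (Pnk n k) = (fun t : R =>
   (c * k%:R) *: (t ^+ k.-1 * (1 - t) ^+ n.+1)
   - (c * n.+1%:R) *: (t ^+ k * (1 - t) ^+ n)).
  apply/funext => t; rewrite derive1E; have [_ ->] := is_derive_Pnk n k t.
  by rewrite /GRing.scale/= -/c; ring.
rewrite derive1E.
have d1 := @is_deriveZ R R R _ (c * k%:R) _ _ _ (is_derive_monomial k.-1 n.+1 x).
have d2 := @is_deriveZ R R R _ (c * n.+1%:R) _ _ _ (is_derive_monomial k n x).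
have [_ ->] := is_deriveB d1 d2.
by rewrite /GRing.scale/=; ring.
Qed.

Lemma Dt_PnkE n k x : 0 < x -> x < 1 -> Dt (Pnk n k) x =
  (k%:R * (k%:R - 1) * (1 - x) ^+ 2 - 2 * k%:R * (n%:R + 1) * x * (1 - x)
   + n%:R * (n%:R + 1) * x ^+ 2) / x * Pnk n k x.
Proof.
move=> x0 x1; rewrite Dt_Pnk /Pnk /phi.
have xn0 : x != 0 by rewrite gt_eqF.
case: n => [|n]; case: k => [|[|k]] /=; rewrite ?exprS ?expr0 -!natr1; by field.
Qed.

(** A second difference in [k] of [k * Pnk n k x], times [n + k]. Summation by parts transfers it to
    the coefficients, which is the origin of [udelta]. *)
Lemma Dt_Pnk_diff n k x : 0 < x -> x < 1 -> Dt (Pnk n k) x =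
  (n%:R + k%:R) * (k.-1%:R * Pnk n k.-1 x - 2 * (k%:R * Pnk n k x)
                   + k.+1%:R * Pnk n k.+1 x).
Proof.
move=> x0 x1; have xn0 : x != 0 by rewrite gt_eqF.
have PS m : m.+1%:R * Pnk n m.+1 x = (n%:R + m%:R + 1) * x * Pnk n m x.
  have E : (m.+1%:R * 'C(n + m.+1, m.+1)%:R = (n%:R + m%:R + 1) * 'C(n + m, m)%:R :> R).
    by rewrite -natrD natr1 -!natrM -mul_bin_diag addnS.
  by rewrite /Pnk exprS !mulrA E; ring.
rewrite Dt_PnkE// PS; case: k => [|k] /=.
  by field.
have kn0 : n%:R + k%:R + 1 != 0 :> R by rewrite -natrD natr1 pnatr_eq0.
have -> : k%:R * Pnk n k x = k%:R * (k.+1%:R * Pnk n k.+1 x) / ((n%:R + k%:R + 1) * x).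
  by rewrite PS; field; rewrite ?kn0 ?xn0.
by rewrite -natr1; field; rewrite ?kn0 ?xn0.
Qed.

End DtPnk.

(** * The norm bound *)

Section OperatorNorm.
Context {R : realType}.
Implicit Types (x : R) (n k : nat).

Lemma series_ge0_le (b : nat -> R) (s : R) N : (forall k, 0 <= b k) ->
  series b @ \oo --> s -> series b N <= s.
Proof.
move=> b0 bs; have <- := cvg_lim (@Rhausdorff R) bs.
apply: nondecreasing_cvgn_le; last by apply/cvg_ex; exists s.
by apply: nondecreasing_series => k _ _.
Qed.

Lemma Pnk_weight_sum n x : 0 <= x -> x < 1 ->
  series (fun k => (n%:R + k%:R) * Pnk n k x) @ \oo --> (n%:R + x) / (1 - x).
Proof.
move=> x0 x1; have y0 : 1 - x != 0 by rewrite subr_eq0 gt_eqF.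
have := @Pnk_quartic_sum R n x n%:R 1 0 0 0 x0 x1.
rewrite (_ : (fun k => _) = fun k => (n%:R + k%:R) * Pnk n k x); last first.
  by apply/funext => k /=; ring.
by move=> H; apply: (cvg_toE H); rewrite -natr1; field.
Qed.

(* Here [z k] is [Ptnk n.+1 k x / Pnk n.+1 k x]. With respect to the law
   [Pnk n ^~ x] of index [n], not [n.+1], [z - 1] is a multiple of the orthogonal
   polynomial of degree 2, which is why the value is so simple. *)
Lemma Pnk_second_moment n x (z := fun k : nat => 1 - n.+1%:R^-1 *
    ((k%:R * (k%:R - 1) * (1 - x) ^+ 2 - 2 * k%:R * (n.+1%:R + 1) * x * (1 - x)
   + n.+1%:R * (n.+1%:R + 1) * x ^+ 2) / x)) : 0 < x -> x < 1 ->
  series (fun k => z k ^+ 2 * Pnk n k x) @ \oo -->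
  ((3 * n.+1%:R + 2) / n.+1%:R : R).
Proof.
move=> x0 x1; have y0 : 1 - x != 0 by rewrite subr_eq0 gt_eqF.
have xn0 : x != 0 by rewrite gt_eqF.
set r : R := n.+1%:R; have r0 : r != 0 by rewrite pnatr_eq0.
pose A := - (1 - x) ^+ 2 / (r * x); pose B := 2 * (r + 1) * (1 - x) / r.
pose C := 1 - (r + 1) * x.
have := @Pnk_quartic_sum R n x (C ^+ 2) (B ^+ 2 + 2 * B * C)
  (2 * A ^+ 2 + 4 * A * B + B ^+ 2 + 2 * A * C) (4 * A ^+ 2 + 2 * A * B)
  (A ^+ 2) (ltW x0) x1.
rewrite (_ : (fun k => _) = fun k => z k ^+ 2 * Pnk n k x); last first.
  apply/funext => k /=; congr (_ * _).
  have -> : z k = C + B * k%:R + A * (k%:R * (k%:R - 1)).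
    by rewrite /z /A /B /C -/r; clearbody r; field; rewrite xn0.
  ring.
move=> H; apply: (cvg_toE H); rewrite -/r /A /B /C; clearbody r; field.
by rewrite ?r0 ?xn0 ?y0.
Qed.

Lemma PnkSn n k x : Pnk n.+1 k x = (n.+1%:R + k%:R) * (1 - x) / n.+1%:R * Pnk n k x.
Proof.
have E : (n.+1%:R * 'C(n.+1 + k, k)%:R = (n.+1%:R + k%:R) * 'C(n + k, k)%:R :> R).
  rewrite -natrD -!natrM; congr (_%:R).
  by have := mul_bin_down (n.+1 + k) k; rewrite addnK /= => <-.
have r0 : n.+1%:R != 0 :> R by rewrite pnatr_eq0.
apply: (mulfI r0); rewrite /Pnk exprS !mulrA E.
by move: (n.+1%:R : R) r0 => r r0; field.
Qed.

(** Cauchy-Schwarz is used termwise, in Young's form: [b k - |Ptnk n.+1 k x|] is a nonnegative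
    multiple of the square of [alpha * |z k| - (r + k)]. The sum of [b] then comes from two known
    series. *)
Lemma Ptnk_abs_sum n N x : (2 <= n)%N -> 0 < x -> x < 1 ->
  \sum_(k < N) `|Ptnk n k x| <= Num.sqrt 6.
Proof.
case: n => // n n1 x0 x1.
have [r rE] : exists r : R, r = n.+1%:R by exists n.+1%:R.
have r2 : 2 <= r by rewrite rE ler_nat.
have y0 : 0 < 1 - x by rewrite subr_gt0.
have s6 : 0 < Num.sqrt 6 :> R by rewrite sqrtr_gt0.
have s6E : Num.sqrt 6 ^+ 2 = 6 :> R by rewrite sqr_sqrtr.
set s := Num.sqrt 6 in s6 s6E *.
(* Chosen so that the second half of the sum of [b] is exactly [s / 2]. *)
pose alpha := (r + x) / ((1 - x) * s).
have a0 : 0 < alpha by rewrite divr_gt0 ?(mulr_gt0 y0)//; lra.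
pose z k := 1 - r^-1 *
    ((k%:R * (k%:R - 1) * (1 - x) ^+ 2 - 2 * k%:R * (r + 1) * x * (1 - x)
   + r * (r + 1) * x ^+ 2) / x).
have rn0 : r != 0 by rewrite gt_eqF//; lra.
pose b k := (alpha * (1 - x) / r / 2) * (z k ^+ 2 * Pnk n k x)
            + (2 * alpha)^-1 * ((r + k%:R) * Pnk n.+1 k x).
have Pb k : `|Ptnk n.+1 k x| <= b k.
  have -> : Ptnk n.+1 k x = z k * Pnk n.+1 k x.
    by rewrite /Ptnk Dt_PnkE// -rE /z; ring.
  have P0 : 0 <= Pnk n k x by apply: Pnk_ge0 => //; exact: ltW.
  have w0 : 0 < r + k%:R by rewrite ltr_pwDl//; lra.
  rewrite /b PnkSn -rE normrM [X in _ * X]ger0_norm; last first.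
    by rewrite mulr_ge0// divr_ge0 ?(mulr_ge0 (ltW w0) (ltW y0))//; lra.
  rewrite -subr_ge0 (_ : _ - _ = (1 - x) / r / (2 * alpha) * Pnk n k x *
      (alpha * `|z k| - (r + k%:R)) ^+ 2); last first.
    by rewrite -(real_normK (num_real (z k))); field; rewrite ?rn0 ?gt_eqF.
  by rewrite mulr_ge0 ?sqr_ge0// mulr_ge0// divr_ge0 ?divr_ge0//; lra.
apply: (@le_trans _ _ (series b N)).
  by rewrite /series/= big_mkord; apply: ler_sum => k _.
have M2 := @Pnk_second_moment n x x0 x1; rewrite -rE in M2.
have W1 := @Pnk_weight_sum n.+1 x (ltW x0) x1; rewrite -rE in W1.
have bs := @cvg_series_lin R _ _ _ _ (alpha * (1 - x) / r / 2) (2 * alpha)^-1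
  M2 W1.
rewrite (le_trans (series_ge0_le _ _ bs))//; first by move=> k; exact: le_trans (Pb k).
rewrite /alpha.
rewrite (_ : _ + _ = (r + x) * (3 * r + 2) / (2 * s * r ^+ 2) + s / 2); last first.
  by field; rewrite rn0 !gt_eqF//; lra.
suff : (r + x) * (3 * r + 2) / (2 * s * r ^+ 2) <= s / 2 by lra.
rewrite ler_pdivrMr; last by rewrite !mulr_gt0 ?exprn_gt0//; lra.
rewrite (_ : s / 2 * _ = s ^+ 2 * r ^+ 2); last by field.
(* What remains is [(r + x) * (3 * r + 2) <= 6 * r ^+ 2] for [r >= 2] and [x < 1]; both sides agree
   at [r = 2], [x = 1]. *)
rewrite s6E; nra.
Qed.

End OperatorNorm.

(** * Telescoping *)

Section PnkSums.
Context {R : realType}.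
Implicit Types (x : R) (n k : nat) (u : nat -> R).

(** The operator [T_n] on coefficient sequences: [T_n f] is the case where [u k] is [unk n k f]. *)
Definition PnkT n u x : R := limn (series (fun k => u k * Pnk n k x)).

(* If [u k] is [unk n k g], then [udelta n u k] is [unk n k (Dt g)]. *)
Definition udelta n u k : R :=
  k%:R * ((n%:R + k%:R + 1) * u k.+1 - 2 * (n%:R + k%:R) * u k
          + (n%:R + k%:R - 1) * u k.-1).

(** If [u k] is [unk n k g], then [unext n u k] is [unk n.+1 k g]; see [unext_unk]. *)
Definition unext n u k : R := u k - k%:R / n%:R * (u k.+1 - u k).

Definition ubounded (M : R) u := forall k, `|u k| <= M.

Lemma dominated_series (a b : nat -> R) (s : R) :
  (forall k, `|a k| <= b k) -> series b @ \oo --> s ->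
  cvgn (series a) /\ `|limn (series a)| <= s.
Proof.
move=> ab bs.
have b0 k : 0 <= b k by exact: le_trans (ab k).
have cb : cvgn (series b) by apply/cvg_ex; exists s.
have ca : cvgn (series a).
  by apply: normed_cvg; exact: (series_le_cvg _ _ ab).
split => //.
have H N : `|series a N| <= s.
  rewrite (le_trans _ (series_ge0_le N b0 bs))// /series/=.
  by rewrite (le_trans (ler_norm_sum _ _ _))// ler_sum.
rewrite -(cvg_lim (@Rhausdorff R) (cvg_norm ca)).
apply: limr_le; last by near=> N; exact: H.
by apply: is_cvg_norm.
Unshelve. all: by end_near. Qed.

Section at_point.
Variable x : R.
Hypotheses (x0 : 0 < x) (x1 : x < 1).

Lemma PnkT_cvg n u M : ubounded M u ->
  series (fun k => u k * Pnk n k x) @ \oo --> PnkT n u x /\ `|PnkT n u x| <= M.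
Proof.
move=> uM.
(* The summand [0 * 0] gives the bound the two-term shape of [cvg_series_lin]. *)
have [] := @dominated_series (fun k => u k * Pnk n k x) (fun k => M * Pnk n k x + 0 * 0) M.
- move=> k; rewrite mul0r addr0 normrM ler_pM//.
  by rewrite ger0_norm// Pnk_ge0// ltW.
- have H := Pnk_sum n (ltW x0) x1.
  have Z : series (fun=> 0 : R) @ \oo --> (0 : R).
    rewrite (_ : series _ = cst 0); first exact: cvg_cst.
    by apply/funext => N; rewrite /series/= big1.
  by apply: (cvg_toE (@cvg_series_lin R _ _ _ _ M 0 H Z)); rewrite mulr1 mulr0 addr0.
- by [].
Qed.

Lemma PnkT_lin n u v (c d Mu Mv : R) : ubounded Mu u -> ubounded Mv v ->
  PnkT n (fun k => c * u k + d * v k) x = c * PnkT n u x + d * PnkT n v x.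
Proof.
move=> /(PnkT_cvg n)[uM _] /(PnkT_cvg n)[vM _].
apply: (cvg_lim (@Rhausdorff R)).
rewrite (_ : (fun k => _) = fun k => c * (u k * Pnk n k x) + d * (v k * Pnk n k x)).
  exact: cvg_series_lin.
by apply/funext => k; ring.
Qed.

Lemma Pnk_square_cvg0 n : (fun k => (k%:R + 1) ^+ 2 * Pnk n k x) @ \oo --> (0 : R).
Proof.
apply: cvg_series_cvg_0.
have := @Pnk_quartic_sum R n x 1 3 1 0 0 (ltW x0) x1.
rewrite (_ : (fun k => _) = fun k => (k%:R + 1) ^+ 2 * Pnk n k x); last first.
  by apply/funext => k /=; ring.
by move=> H; apply/cvg_ex; eexists; exact: H.
Qed.

Lemma Pnk_tail_cvg0 n (a : nat -> R) (C : R) :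
  (forall k, `|a k| <= C * (k%:R + 1) ^+ 2) ->
  (fun k => a k * Pnk n k x) @ \oo --> (0 : R).
Proof.
move=> aC; apply: norm_cvg0.
have H : (fun k => C * ((k%:R + 1) ^+ 2 * Pnk n k x)) @ \oo --> (0 : R).
  rewrite -(mulr0 C); apply: cvgM; [exact: cvg_cst|exact: Pnk_square_cvg0].
apply: (squeeze_cvgr _ (cvg_cst (0 : R)) H); near=> k; rewrite normr_ge0/= normrM mulrA.
by rewrite [X in _ * X]ger0_norm ?ler_wpM2r// Pnk_ge0// ltW.
Unshelve. all: by end_near. Qed.

Lemma series_Dt_Pnk n u N :
  series (fun k => u k * Dt (Pnk n k) x) N.+1 =
  series (fun k => udelta n u k * Pnk n k x) N.+1
  + ((n%:R + N%:R) * u N * N.+1%:R * Pnk n N.+1 x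
     - (n%:R + N.+1%:R) * u N.+1 * N%:R * Pnk n N x).
Proof.
elim: N => [|N IH].
  by rewrite /series/= !big_nat1 Dt_Pnk_diff// /udelta /=; ring.
rewrite ![series _ N.+2](seriesSr) IH Dt_Pnk_diff// /udelta /=.
by rewrite -!natr1; ring.
Qed.

(** D acts on each term, as in [Ptnk], so that no sum is differentiated. For bounded [u] the
    boundary terms of the summation by parts are at most quadratic in [k] times [Pnk n k x], hence
    tend to 0. *)
Lemma PnkT_Dt n u M M' : ubounded M u -> ubounded M' (udelta n u) ->
  series (fun k => u k * Dt (Pnk n k) x) @ \oo --> PnkT n (udelta n u) x.
Proof.
move=> uM duM; rewrite -cvg_shiftS.
rewrite (_ : (fun N => _) = fun N => series (fun k => udelta n u k * Pnk n k x) N.+1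
  + ((fun k => (n%:R + k.-1%:R) * u k.-1 * k%:R * Pnk n k x) N.+1
     - (n%:R + N.+1%:R) * u N.+1 * N%:R * Pnk n N x)); last first.
  by apply/funext => N; exact: series_Dt_Pnk.
apply: (@cvg_toE _ _ _ _ (PnkT n (udelta n u) x + (0 - 0))); last by rewrite subr0 addr0.
have M0 : 0 <= M by exact: le_trans (uM 0%N).
have n0 : 0 <= n%:R :> R by [].
apply: cvgD.
  rewrite (cvg_shiftS (series (fun k => udelta n u k * Pnk n k x))).
  by have [] := PnkT_cvg n duM.
apply: cvgB.
  rewrite (cvg_shiftS (fun k => (n%:R + k.-1%:R) * u k.-1 * k%:R * Pnk n k x)).
  apply: (@Pnk_tail_cvg0 n _ ((n%:R + 1) * M)) => k.
  have k0 : 0 <= k%:R :> R by [].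
  have kk : k.-1%:R <= k%:R :> R by rewrite ler_nat leq_pred.
  have k1 : 0 <= k.-1%:R :> R by [].
  rewrite !normrM (ger0_norm (addr_ge0 n0 k1)) (ger0_norm k0).
  have := uM k.-1; have : 0 <= `|u k.-1| by [].
  move: (`|u _|) (k.-1%:R) (k%:R) (n%:R) n0 k0 kk k1 => v p q r *.
  apply: (@le_trans _ _ ((r + q) * M * q)).
    by rewrite ler_wpM2r// ler_pM// ?addr_ge0// lerD2l.
  rewrite -subr_ge0 (_ : _ - _ = M * (r * q ^+ 2 + r * q + r + 2 * q + 1)); last by ring.
  by rewrite mulr_ge0// !addr_ge0// ?mulr_ge0.
apply: (@Pnk_tail_cvg0 n _ ((n%:R + 1) * M)) => k.
have k0 : 0 <= k%:R :> R by [].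
rewrite -natr1 !normrM (ger0_norm k0) (ger0_norm (_ : 0 <= n%:R + (k%:R + 1))); last first.
  by rewrite !addr_ge0.
have := uM k.+1; have : 0 <= `|u k.+1| by [].
move: (`|u _|) (k%:R) (n%:R) n0 k0 => v q r *.
apply: (@le_trans _ _ ((r + (q + 1)) * M * q)).
  by rewrite ler_wpM2r// ler_wpM2l// !addr_ge0.
rewrite -subr_ge0 (_ : _ - _ = M * (r * q ^+ 2 + r * q + r + q + 1)); last by ring.
by rewrite mulr_ge0// !addr_ge0// ?mulr_ge0.
Qed.

Lemma PnkS_diff n k : Pnk n.+1 k x =
  Pnk n k x + (k%:R * Pnk n k x - k.+1%:R * Pnk n k.+1 x) / n.+1%:R.
Proof.
have n0 : n.+1%:R != 0 :> R by rewrite pnatr_eq0.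
have y0 : 1 - x != 0 by rewrite subr_eq0 gt_eqF.
have -> : k.+1%:R * Pnk n k.+1 x = n.+1%:R * x / (1 - x) * Pnk n.+1 k x.
  by apply: (mulfI y0); rewrite mulrA (mulrC (1 - x)) PnkS; field.
by rewrite PnkSn; move: (n.+1%:R : R) n0 => r r0; field; rewrite r0.
Qed.

(** By [PnkS_diff], raising [n] adds to [Pnk n k x] a first difference in [k]. Summation by parts
    moves that difference onto [unext n u], itself made of first differences of [u], and together
    they form the second difference [udelta]. *)
Lemma series_unext n u N : (0 < n)%N ->
  series (fun k => unext n u k * Pnk n.+1 k x) N.+1 =
  series (fun k => (1 * u k + (- (n%:R * (n%:R + 1))^-1) * udelta n u k) * Pnk n k x) N.+1
  - unext n u N * N.+1%:R / n.+1%:R * Pnk n N.+1 x.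
Proof.
move=> n0; have nn0 : n%:R != 0 :> R by rewrite pnatr_eq0 -lt0n.
have n1 : n%:R + 1 != 0 :> R by rewrite natr1 pnatr_eq0.
elim: N => [|N IH].
  rewrite /series/= !big_nat1 PnkS_diff /udelta /unext/= -!natr1.
  move: (n%:R : R) nn0 n1 => r *; field; exact/andP.
rewrite ![series _ N.+2](seriesSr) IH PnkS_diff /udelta /unext /= -!natr1.
move: (n%:R : R) nn0 n1 => r *; field; exact/andP.
Qed.

Lemma PnkT_unext n u M M' M'' : (0 < n)%N -> ubounded M u ->
  ubounded M' (unext n u) -> ubounded M'' (udelta n u) ->
  PnkT n.+1 (unext n u) x =
  PnkT n u x - (n%:R * (n%:R + 1))^-1 * PnkT n (udelta n u) x.
Proof.
move=> n0 uM nM dM; rewrite [LHS]/PnkT.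
apply: (cvg_lim (@Rhausdorff R)); rewrite -cvg_shiftS.
rewrite (_ : (fun N => _) = fun N =>
  series (fun k => (1 * u k + (- (n%:R * (n%:R + 1))^-1) * udelta n u k) * Pnk n k x) N.+1
  - (fun k => unext n u k.-1 * k%:R / n.+1%:R * Pnk n k x) N.+1); last first.
  by apply/funext => N; exact: series_unext.
set l := PnkT n u x - _; apply: (@cvg_toE _ _ _ _ (l - 0)); last by rewrite subr0.
rewrite /l {l}.
apply: cvgB.
  rewrite (cvg_shiftS (series (fun k => (1 * u k + (- (n%:R * (n%:R + 1))^-1) * udelta n u k) * Pnk n k x))).
  have [cu _] := PnkT_cvg n uM; have [cd _] := PnkT_cvg n dM.
  have := @cvg_series_lin R _ _ _ _ 1 (- (n%:R * (n%:R + 1))^-1) cu cd.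
  rewrite mul1r mulNr (_ : (fun k => _) = fun k =>
    (1 * u k + (- (n%:R * (n%:R + 1))^-1) * udelta n u k) * Pnk n k x)//.
  by apply/funext => k; ring.
rewrite (cvg_shiftS (fun k => unext n u k.-1 * k%:R / n.+1%:R * Pnk n k x)).
apply: (@Pnk_tail_cvg0 n _ M') => k.
have M0 : 0 <= M' by exact: le_trans (nM 0%N).
have k0 : 0 <= k%:R :> R by [].
rewrite !normrM (ger0_norm k0) -mulrA ler_pM//.
rewrite ger0_norm ?invr_ge0// ler_pdivrMr//.
have n1 : 1 <= n.+1%:R :> R by rewrite ler1n.
nra.
Qed.

End at_point.
End PnkSums.

(** * The telescoping estimate for abstract coefficients *)

Section Telescoping.
Context {R : realType}.
Variables (x : R) (n : nat) (U V : nat -> nat -> R) (G C B gx : R).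
Hypotheses (x0 : 0 < x) (x1 : x < 1) (n0 : (0 < n)%N).
Hypothesis UE : forall m, (n <= m)%N -> unext m (U m) = U m.+1.
Hypothesis VE : forall m, (n <= m)%N -> unext m (V m) = V m.+1.
Hypothesis dU : forall m, (n <= m)%N -> udelta m (U m) = V m.
Hypothesis Ub : forall m, (n <= m)%N -> ubounded G (U m).
Hypothesis Vb : forall m, (n <= m)%N -> ubounded C (V m).
Hypothesis dVb : forall m, (n <= m)%N -> ubounded B (udelta m (V m)).
Hypothesis Ucvg : (fun m => PnkT m (U m) x) @ \oo --> gx.

Let E m := PnkT m (U m) x.
Let F m := PnkT m (V m) x.

Let ES m : (n <= m)%N -> E m.+1 = E m - (m%:R * (m%:R + 1))^-1 * F m.
Proof.
move=> nm; rewrite /E -UE// /F -dU//.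
apply: (PnkT_unext x0 x1 (leq_trans n0 nm) (Ub nm)).
  by rewrite UE//; exact/Ub/leqW.
by rewrite dU//; exact: Vb.
Qed.

Let FS m : (n <= m)%N -> `|F m.+1 - F m| <= (m%:R * (m%:R + 1))^-1 * B.
Proof.
move=> nm; rewrite /F -VE// (@PnkT_unext R x x0 x1 m (V m) C C B (leq_trans n0 nm) (Vb nm) _ (dVb nm)); last first.
  by rewrite VE//; exact/Vb/leqW.
rewrite addrAC subrr sub0r normrN normrM ger0_norm ?invr_ge0 ?mulr_ge0//.
by rewrite ler_wpM2l ?invr_ge0 ?mulr_ge0//; have [] := PnkT_cvg x0 x1 m (dVb nm).
Qed.

Let B0 : 0 <= B. Proof. exact: le_trans (dVb (leqnn n) 0%N). Qed.

Let inv_diff (m : nat) : (n <= m)%N ->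
  (m%:R * (m%:R + 1))^-1 = m%:R^-1 - m.+1%:R^-1 :> R.
Proof.
move=> nm; have m0 : m%:R != 0 :> R by rewrite pnatr_eq0 -lt0n (leq_trans n0).
have m1 : m%:R + 1 != 0 :> R by rewrite natr1 pnatr_eq0.
rewrite -natr1; move: (m%:R : R) m0 m1 => r *; field; exact/andP.
Qed.

Let Fdiff m : (n <= m)%N -> `|F m - F n| <= B * (n%:R^-1 - m%:R^-1).
Proof.
elim: m => [|m IH]; first by rewrite leqn0 => /eqP ->; rewrite !subrr normr0 mulr0.
rewrite leq_eqVlt => /predU1P[<-|]; first by rewrite !subrr normr0 mulr0.
rewrite ltnS => nm.
rewrite -(subrK (F m) (F m.+1)) -addrA (le_trans (ler_normD _ _))//.
rewrite (le_trans (lerD (FS nm) (IH nm)))// inv_diff// le_eqVlt; apply/orP; left.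
by apply/eqP; ring.
Qed.

(** Passing from [m] to [m + 1] adds [(1/m - 1/(m+1)) (F m - F n)], whose second factor is at most
    [B / n] by [Fdiff]. Letting [m] tend to infinity then leaves the total weight [1 / n]. *)
Let Ediff m : (n <= m)%N ->
  `|E n - E m - (n%:R^-1 - m%:R^-1) * F n| <= B / n%:R * (n%:R^-1 - m%:R^-1).
Proof.
elim: m => [|m IH]; first by rewrite leqn0 => /eqP ->; rewrite !subrr mul0r subrr normr0 mulr0.
rewrite leq_eqVlt => /predU1P[<-|]; first by rewrite !subrr mul0r subrr normr0 mulr0.
rewrite ltnS => nm; rewrite ES// inv_diff//.
have d0 : 0 <= m%:R^-1 - m.+1%:R^-1 :> R.
  by rewrite -inv_diff// invr_ge0 mulr_ge0.
rewrite [X in `|X|](_ : _ = (E n - E m - (n%:R^-1 - m%:R^-1) * F n)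
   + (m%:R^-1 - m.+1%:R^-1) * (F m - F n)); last by ring.
rewrite (le_trans (ler_normD _ _))//.
have : `|(m%:R^-1 - m.+1%:R^-1) * (F m - F n)| <=
    (m%:R^-1 - m.+1%:R^-1) * (B / n%:R).
  rewrite normrM ger0_norm// ler_wpM2l// (le_trans (Fdiff nm))// ler_wpM2l//.
  by rewrite gerBl invr_ge0.
move=> /(lerD (IH nm))/le_trans; apply; rewrite le_eqVlt; apply/orP; left.
by apply/eqP; ring.
Qed.

Lemma telescoping_bound : `|E n - n%:R^-1 * F n - gx| <= B / n%:R ^+ 2.
Proof.
have inv0 : (fun m : nat => m%:R^-1 : R) @ \oo --> (0 : R).
  rewrite -cvg_shiftS; exact: cvg_harmonic.
have lim : (fun m => `|E n - E m - (n%:R^-1 - m%:R^-1) * F n|) @ \oo -->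
    `|E n - gx - (n%:R^-1 - 0) * F n|.
  apply: cvg_norm; apply: cvgB; first by apply: cvgB => //; exact: cvg_cst.
  by apply: cvgM; [apply: cvgB => //; exact: cvg_cst|exact: cvg_cst].
have -> : E n - n%:R^-1 * F n - gx = E n - gx - (n%:R^-1 - 0) * F n by ring.
rewrite -(cvg_lim (@Rhausdorff R) lim); apply: limr_le; first by apply/cvg_ex; eexists; exact: lim.
near=> m; have nm : (n <= m)%N by near: m; exact: nbhs_infty_ge.
rewrite (le_trans (Ediff nm))// expr2 invfM mulrA ler_wpM2l ?divr_ge0//.
by rewrite gerBl invr_ge0.
Unshelve. all: by end_near. Qed.

End Telescoping.

(** * The functionals [unk] *)

Section Moments.
Context {R : realType}.
Let mu : {measure set (measurableTypeR R) -> \bar R} := @lebesgue_measure R.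
Implicit Types (f g : R -> R) (i m n k : nat).

(* The factor [1 - t] in the last clause leaves room for [f] unbounded at 1,
   as is the case of the comparison function [x ln(x / (1 - x))] below. *)
Definition admissible f :=
  [/\ {in `]0, 1[, continuous f}, f @ 0^'+ --> f 0 &
      (1 - t) * f t @[t --> 1^'-] --> (0 : R)].

(** The interval is closed so that, for [0 < m] and admissible [f], the integrand is continuous on a
    compact set: it vanishes at 1 whatever [f 1] is. *)
Definition moment i m f : R :=
  \int[mu]_(t in `[0, 1]) (t ^+ i * (1 - t) ^+ m * f t).

Lemma continuous_monomial i m : continuous (fun t : R => t ^+ i * (1 - t) ^+ m).
Proof.
move=> x; apply: differentiable_continuous; apply/derivable1_diffP.
by have [] := is_derive_monomial i m x.
Qed.

Lemma admissible_within f i m : admissible f ->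
  {within `[0, 1], continuous (fun t => t ^+ i * (1 - t) ^+ m.+1 * f t)}.
Proof.
move=> [fc f0 f1]; apply/continuous_within_itvP => //; split.
- move=> x x01; apply: cvgM; [exact: continuous_monomial|exact: fc].
- apply: cvgM => //; apply: cvg_at_right_filter; exact: continuous_monomial.
- rewrite subrr exprS mul0r mulr0 mul0r.
  rewrite (_ : (fun t => _) = fun t => (t ^+ i * (1 - t) ^+ m) * ((1 - t) * f t)); last first.
    by apply/funext => t; rewrite exprS; ring.
  apply: (@cvg_toE _ _ _ _ (1 ^+ i * (1 - 1) ^+ m * 0)); last by rewrite mulr0.
  apply: cvgM => //.
  by apply: cvg_at_left_filter; exact: (@continuous_monomial i m 1).
Qed.

Lemma moment_integrable f i m : admissible f -> (0 < m)%N ->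
  mu.-integrable `[0, 1] (EFin \o (fun t => t ^+ i * (1 - t) ^+ m * f t)).
Proof.
case: m => // m fa _; apply: continuous_compact_integrable.
  exact: segment_compact.
exact: admissible_within.
Qed.

Lemma admissible_lin f g (a b : R) : admissible f -> admissible g ->
  admissible (fun t => a * f t + b * g t).
Proof.
move=> [fc f0 f1] [gc g0 g1]; split.
- move=> x x01; apply: cvgD; apply: cvgM; try exact: cvg_cst; [exact: fc|exact: gc].
- by apply: cvgD; apply: cvgM => //; exact: cvg_cst.
- rewrite (_ : (fun t => _) = fun t => a * ((1 - t) * f t) + b * ((1 - t) * g t)); last first.
    by apply/funext => t; ring.
  apply: (@cvg_toE _ _ _ _ (a * 0 + b * 0)); last by rewrite !mulr0 addr0.
  by apply: cvgD; apply: cvgM => //; exact: cvg_cst.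
Qed.

Lemma moment_lin f g (a b : R) i m : admissible f -> admissible g -> (0 < m)%N ->
  moment i m (fun t => a * f t + b * g t) = a * moment i m f + b * moment i m g.
Proof.
move=> fa ga m0; have fi := moment_integrable i fa m0.
have gi := moment_integrable i ga m0.
rewrite /moment -RintegralZl// -RintegralZl// -RintegralD//; first last.
- by apply: (integrableZl _ b gi).
- by apply: (integrableZl _ a fi).
by apply: eq_Rintegral => t _; ring.
Qed.

Lemma momentS f i m : admissible f -> (0 < m)%N ->
  moment i m.+1 f = moment i m f - moment i.+1 m f.
Proof.
move=> fa m0; rewrite /moment -RintegralB//; last 2 first.
- exact: moment_integrable.
- exact: moment_integrable.
by apply: eq_Rintegral => t _ /=; rewrite !exprS; ring.
Qed.

Lemma moment1 i m : moment i m (cst 1) = (i`! * m`!)%:R / (i + m).+1`!%:R.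
Proof.
rewrite -beta_fun_fact /beta_fun -Rintegral_mkcond /moment.
by apply: eq_Rintegral => t _; rewrite mulr1.
Qed.

(** The factor [(1 - t) ^- 2] lowers the exponent [n.+1] to [n.-1], which is positive as [1 < n];
    [moment] of an admissible function needs this. *)
Lemma unkE f n k : (1 < n)%N -> admissible f ->
  unk n k.+1 f = n%:R * 'C(n + k, k)%:R * moment k n.-1 f.
Proof.
case: n => // n n0 fa; rewrite /unk -mulrA; congr (_ * _).
have fi := moment_integrable k fa n0.
rewrite /= /moment -RintegralZl//.
have ci : mu.-integrable `[0, 1] (EFin \o (fun t =>
    'C(n.+1 + k, k)%:R * (t ^+ k * (1 - t) ^+ n * f t))).
  exact: (integrableZl _ _ fi).
rewrite -Rintegral_itv_obnd_cbnd; last first.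
  by apply: integrableS ci => //; exact: subset_itv_oc_cc.
rewrite -Rintegral_itv_bndo_bndc; last first.
  by apply: integrableS ci => //; exact: subset_itv_oo_cc.
apply: eq_Rintegral => t; rewrite inE/= in_itv/= => /andP[t0 t1].
have t10 : 1 - t != 0 by rewrite subr_eq0 gt_eqF.
by rewrite /Pnk -exprVn !exprS expr0 mulr1; field.
Qed.

Lemma unk_lin n k f g (a b : R) : (1 < n)%N -> admissible f -> admissible g ->
  unk n k (fun t => a * f t + b * g t) = a * unk n k f + b * unk n k g.
Proof.
case: k => // k n1 fa ga; rewrite !unkE//; last exact: admissible_lin.
by rewrite moment_lin//; [ring|case: n n1].
Qed.

(** Raising the exponent of [1 - t] by one is a difference of two moments ([momentS]); the rest is
    the ratio of consecutive binomials. At index 0 both sides are [f 0]. *)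
Lemma unext_unk n f : (1 < n)%N -> admissible f ->
  unext n (fun k => unk n k f) = fun k => unk n.+1 k f.
Proof.
case: n => // n n1 fa; apply/funext => -[|k].
  by rewrite /unext /= !mul0r subr0.
rewrite /unext !unkE//= momentS//.
have c0 : n.+1%:R != 0 :> R by rewrite pnatr_eq0.
have c1 : k.+1%:R != 0 :> R by rewrite pnatr_eq0.
have E1 : 'C(n.+1 + k.+1, k.+1)%:R = (n.+1 + k.+1)%:R / k.+1%:R * 'C(n.+1 + k, k)%:R :> R.
  apply: (mulfI c1); rewrite mulrA mulrCA divff// mulr1 -!natrM; congr (_%:R).
  by rewrite addnS -mul_bin_diag.
have E2 : 'C(n.+2 + k, k)%:R = (n.+1 + k.+1)%:R / n.+2%:R * 'C(n.+1 + k, k)%:R :> R.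
  have c2 : n.+2%:R != 0 :> R by rewrite pnatr_eq0.
  apply: (mulfI c2); rewrite mulrA mulrCA divff// mulr1 -!natrM; congr (_%:R).
  by have := mul_bin_down (n.+2 + k) k; rewrite addnK /= addSnnS => <-.
rewrite E1 E2 -!natr1 natrD -!natr1.
move: (moment _ _ _) (moment _ _ _) => u v.
have c2 : n%:R + 1 + 1 != 0 :> R by rewrite !natr1 pnatr_eq0.
rewrite -natr1 in c0; rewrite -natr1 in c1.
by field; rewrite c0 c1 c2.
Qed.

Lemma moment_ge0 f i m : (forall t, t \in `[0, 1] -> 0 <= t ^+ i * (1 - t) ^+ m * f t) ->
  0 <= moment i m f.
Proof. by move=> f0; apply: Rintegral_ge0 => t /f0. Qed.

Lemma unk_cst n k : (1 < n)%N -> unk n k (cst 1 : R -> R) = 1.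
Proof.
case: k => // k n1; rewrite unkE//; last first.
  split => [x _||]; try exact: cvg_cst.
  rewrite (_ : (fun t => _) = fun t : R => t ^+ 0 * (1 - t) ^+ 1); last first.
    by apply/funext => t; rewrite expr0 mul1r expr1 mulr1.
  have := @continuous_monomial 0 1 1; rewrite /continuous_at /= subrr expr1 mulr0.
  exact: cvg_at_left_filter.
rewrite moment1; case: n n1 => // n n1 /=.
have -> : (k + n).+1 = (n.+1 + k)%N by rewrite addSn addnC.
have := bin_fact (leq_addl n.+1 k); rewrite addnK factS => <-.
have h0 j : j`!%:R != 0 :> R by rewrite pnatr_eq0 -lt0n fact_gt0.
have c0 : n.+1%:R != 0 :> R by rewrite pnatr_eq0.
have b0 : 'C(n.+1 + k, k)%:R != 0 :> R.
  by rewrite pnatr_eq0 -lt0n bin_gt0 leq_addl.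
rewrite !natrM; move: (h0 k) (h0 n) c0 b0.
move: (k`!%:R : R) (n`!%:R : R) (n.+1%:R : R) ('C(_, _)%:R : R) => p q r s *.
by field; apply/and4P.
Qed.

Lemma admissible_cst (c : R) : admissible (cst c).
Proof.
split => [x _||]; try exact: cvg_cst.
have := @continuous_monomial 0 1 1; rewrite /continuous_at /= subrr expr1 mulr0.
move=> /cvg_at_left_filter H.
apply: (@cvg_toE _ _ _ _ (0 * c)); last by rewrite mul0r.
apply: cvgM; last exact: cvg_cst.
by apply: cvg_trans H; apply: near_eq_cvg; near=> t; rewrite expr0 mul1r expr1.
Unshelve. all: by end_near. Qed.

(** [unk n k] is positive and sends 1 to 1, so it suffices to apply it to [M + f] and [M - f]; [e]
    is the sign. *)
Lemma unk_bounded n f (M : R) : (1 < n)%N -> admissible f ->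
  (forall t, 0 <= t -> t < 1 -> `|f t| <= M) -> ubounded M (fun k => unk n k f).
Proof.
move=> n1 fa fM [|k]; first by rewrite /unk fM.
suff pos (e : R) : `|e| = 1 -> 0 <= M + e * unk n k.+1 f.
  rewrite ler_norml; have := pos 1; have := pos (-1).
  by rewrite normrN1 normr1 => /(_ erefl) ? /(_ erefl) ?; apply/andP; split; lra.
move=> e1.
have -> : M + e * unk n k.+1 f = unk n k.+1 (fun t => M * cst 1 t + e * f t).
  by rewrite unk_lin ?unk_cst ?mulr1//; exact: admissible_cst.
rewrite unkE//; last by apply: admissible_lin => //; exact: admissible_cst.
rewrite mulr_ge0//; apply: moment_ge0 => t; rewrite in_itv/= => /andP[t0].
rewrite le_eqVlt => /predU1P[->|t1].
  (* No bound on [f 1] is available, but the weight vanishes at 1. *)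
  by case: n n1 => [|[|n]]//= _; rewrite subrr exprS mul0r mulr0 mul0r.
rewrite !mulr_ge0 ?exprn_ge0//; first by rewrite subr_ge0 ltW.
have : `|e * f t| <= M by rewrite normrM e1 mul1r fM.
by rewrite ler_norml => /andP[]; lra.
Qed.

Lemma admissible_bounded f (M : R) : {in `]0, 1[, continuous f} ->
  f @ 0^'+ --> f 0 -> (forall t, 0 < t -> t < 1 -> `|f t| <= M) -> admissible f.
Proof.
move=> fc f0 fM; split => //; apply: norm_cvg0.
have H : (1 - t) * M @[t --> 1^'-] --> (0 : R).
  apply: (@cvg_toE _ _ _ _ ((1 - 1) * M)); last by rewrite subrr mul0r.
  apply: cvgM; last exact: cvg_cst.
  by apply: cvg_at_left_filter; apply: cvgB; [exact: cvg_cst|exact: cvg_id].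
apply: (squeeze_cvgr _ (cvg_cst (0 : R)) H); near=> t.
have t1 : t < 1 by near: t; exact: nbhs_left_lt.
have t0 : 0 < t by near: t; exact: nbhs_left_gt.
have t10 : 0 <= 1 - t by rewrite subr_ge0 ltW.
by rewrite normr_ge0/= normrM (ger0_norm t10) ler_wpM2l// fM.
Unshelve. all: by end_near. Qed.

End Moments.

(** * Integration by parts and convexity *)

Section IntegrationByParts.
Context {R : realType}.
Let mu : {measure set (measurableTypeR R) -> \bar R} := @lebesgue_measure R.
Implicit Types (f g : R -> R) (i m n k : nat).

(** The mean value theorem for [Q - F], with [Q] a primitive of [r]. It lets one integrate an
    inequality on a derivative [dF] about which only a pointwise bound is known. *)
Lemma derive_le_Rintegral (F dF r : R -> R) (a b : R) : a < b ->
  {within `[a, b], continuous F} -> {within `[a, b], continuous r} ->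
  (forall t : R, t \in `]a, b[ -> is_derive t 1 F (dF t)) ->
  (forall t : R, t \in `]a, b[ -> dF t <= r t) ->
  F b - F a <= \int[mu]_(t in `[a, b]) r t.
Proof.
move=> ab Fc rc FdF dFr.
have ir : mu.-integrable `[a, b] (EFin \o r).
  by apply: continuous_compact_integrable => //; exact: segment_compact.
pose Q x := parameterized_integral mu a x r.
have Qc : {within `[a, b], continuous Q}.
  exact: parameterized_integral_continuous (ltW ab) ir.
have dQ t : t \in `]a, b[ -> is_derive t 1 Q (r t).
  move=> tab; have /andP[at_ tb] : a < t < b by move: tab; rewrite in_itv.
  have [|dQ Qr] := continuous_FTC1_closed tb ir at_.
    exact: within_continuous_continuous tab.
  by apply: DeriveDef; [exact: dQ|rewrite -derive1E].
have dQF t : t \in `]a, b[ -> is_derive t 1 (Q - F) (r t - dF t).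
  by move=> tab; apply: is_deriveB; [exact: dQ|exact: FdF].
have [|c cab] := MVT ab dQF; first exact: within_continuousB.
have -> : (Q - F) b - (Q - F) a = \int[mu]_(t in `[a, b]) r t - (F b - F a).
  rewrite -[(Q - F) b]/(Q b - F b) -[(Q - F) a]/(Q a - F a).
  have -> : Q a = 0 by rewrite /Q /parameterized_integral set_itv1 Rintegral_set1.
  by rewrite /Q /parameterized_integral; ring.
by move=> E; rewrite -subr_ge0 E mulr_ge0 ?subr_ge0 ?dFr// ltW.
Qed.

Lemma FTC_within (F r : R -> R) (a b : R) : a < b ->
  {within `[a, b], continuous F} -> {within `[a, b], continuous r} ->
  (forall t : R, t \in `]a, b[ -> is_derive t 1 F (r t)) ->
  \int[mu]_(t in `[a, b]) r t = F b - F a.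
Proof.
move=> ab Fc rc dF; have /continuous_within_itvP-/(_ ab)[Fo Fa Fb] := Fc.
have ir : mu.-integrable `[a, b] (EFin \o r).
  by apply: continuous_compact_integrable => //; exact: segment_compact.
apply: EFin_inj; rewrite EFinB -(continuous_FTC2 (f := r) (F := F) ab rc); last 2 first.
- by split => // t /dF[].
- by move=> t /dF[_]; rewrite derive1E.
by rewrite /Rintegral fineK//; exact: integrable_fin_num.
Qed.

(** With [p = t ^+ i.+1 * (1 - t) ^+ m.+2], which is [t ^+ i * (1 - t) ^+ m * phi t], this is the
    integral of [p'' f] plus the boundary term [p'(0) f(0)], present only for [i = 0]. For smooth
    [f] it is thus the moment of [D f]. Expanding [p''] with the single power [(1 - t) ^+ m]
    involves only moments belonging to the same [n]. *)
Definition convex_moment i m f : R :=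
  (m%:R + i%:R + 2) * (m%:R + i%:R + 3) * moment i.+1 m f
  - 2 * i.+1%:R * (m%:R + i%:R + 2) * moment i m f
  + i.+1%:R * i%:R * moment i.-1 m f + (i == 0)%:R * f 0.

Lemma convex_moment_lin f g (a b : R) i m : admissible f -> admissible g ->
  (0 < m)%N -> convex_moment i m (fun t => a * f t + b * g t) =
  a * convex_moment i m f + b * convex_moment i m g.
Proof. by move=> fa ga m0; rewrite /convex_moment !moment_lin//; ring. Qed.

(* the second derivative of [t ^+ i.+1 * (1 - t) ^+ m.+2] *)
Let p2 i m (t : R) :=
  (m%:R + i%:R + 2) * (m%:R + i%:R + 3) * (t ^+ i.+1 * (1 - t) ^+ m)
  - 2 * i.+1%:R * (m%:R + i%:R + 2) * (t ^+ i * (1 - t) ^+ m)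
  + i.+1%:R * i%:R * (t ^+ i.-1 * (1 - t) ^+ m).

Let p1 i m (t : R) :=
  i.+1%:R * (t ^+ i * (1 - t) ^+ m.+2) - m.+2%:R * (t ^+ i.+1 * (1 - t) ^+ m.+1).

Let dp i m (t : R) : is_derive t 1 (fun t => t ^+ i.+1 * (1 - t) ^+ m.+2) (p1 i m t).
Proof.
by apply: (is_derive_eq (is_derive_monomial i.+1 m.+2 t)); rewrite /p1 /=; ring.
Qed.

Let dp1 i m (t : R) : is_derive t 1 (p1 i m) (p2 i m t).
Proof.
have d1 := @is_deriveZ R R R _ (i.+1%:R) _ _ _ (is_derive_monomial i m.+2 t).
have d2 := @is_deriveZ R R R _ (m.+2%:R) _ _ _ (is_derive_monomial i.+1 m.+1 t).
have := is_deriveB d1 d2; rewrite /GRing.scale/= => d3.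
apply: (@is_derive_eq _ _ _ _ _ _ _ _ d3).
by rewrite /p2; case: i {d1 d2 d3} => [|i] /=; rewrite !exprS ?expr0 -!natr1; ring.
Qed.

Let within_lin (A : set R) f g (a b : R) : {within A, continuous f} ->
  {within A, continuous g} -> {within A, continuous (fun t => a * f t + b * g t)}.
Proof.
by move=> fc gc x; apply: cvgD; apply: cvgM; try exact: cvg_cst; [exact: fc|exact: gc].
Qed.

Let p1_within f i m : admissible f ->
  {within `[0, 1], continuous (fun t => p1 i m t * f t)}.
Proof.
move=> fa; rewrite (_ : (fun t => _) = fun t => i.+1%:R * (t ^+ i * (1 - t) ^+ m.+2 * f t)
   + - m.+2%:R * (t ^+ i.+1 * (1 - t) ^+ m.+1 * f t)).
  by apply: within_lin; exact: admissible_within.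
by apply/funext => t; rewrite /p1; ring.
Qed.

Let p2E f i m t : p2 i m t * f t =
  1 * ((m%:R + i%:R + 2) * (m%:R + i%:R + 3) * (t ^+ i.+1 * (1 - t) ^+ m * f t)
  + - (2 * i.+1%:R * (m%:R + i%:R + 2)) * (t ^+ i * (1 - t) ^+ m * f t))
  + i.+1%:R * i%:R * (t ^+ i.-1 * (1 - t) ^+ m * f t).
Proof. by rewrite /p2; ring. Qed.

Let p2_within f i m : (0 < m)%N -> admissible f ->
  {within `[0, 1], continuous (fun t => p2 i m t * f t)}.
Proof.
case: m => // m _ fa; rewrite (funext (p2E f i m.+1)).
by apply: within_lin; first apply: within_lin; exact: admissible_within.
Qed.

Let Rintegral_lin f g (a b : R) : mu.-integrable `[0, 1] (EFin \o f) ->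
  mu.-integrable `[0, 1] (EFin \o g) ->
  mu.-integrable `[0, 1] (EFin \o (fun t => a * f t + b * g t)) /\
  \int[mu]_(t in `[0, 1]) (a * f t + b * g t) =
  a * \int[mu]_(t in `[0, 1]) f t + b * \int[mu]_(t in `[0, 1]) g t.
Proof.
move=> fi gi.
have fi' : mu.-integrable `[0, 1] (EFin \o (fun t => a * f t)) by exact: (integrableZl _ a fi).
have gi' : mu.-integrable `[0, 1] (EFin \o (fun t => b * g t)) by exact: (integrableZl _ b gi).
split; first exact: (integrableD _ fi' gi').
by rewrite RintegralD// !RintegralZl.
Qed.

Let p2_integral f i m : (0 < m)%N -> admissible f ->
  \int[mu]_(t in `[0, 1]) (p2 i m t * f t) = convex_moment i m f - (i == 0)%:R * f 0.
Proof.
move=> m0 fa; under eq_Rintegral => t _ do rewrite p2E.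
rewrite /convex_moment.
have M j := moment_integrable j fa m0.
have [I1 E1] := Rintegral_lin ((m%:R + i%:R + 2) * (m%:R + i%:R + 3))
  (- (2 * i.+1%:R * (m%:R + i%:R + 2))) (M i.+1) (M i).
have [I2 ->] := Rintegral_lin 1 (i.+1%:R * i%:R) I1 (M i.-1).
by rewrite E1 /moment -/mu; ring.
Qed.

(** The function [F = p psi' - p' psi] has derivative [p psi'' - p'' psi]. Since [dpsi] may blow up
    at the ends, it enters as [t * (1 - t) * dpsi t], whose admissibility makes [F] continuous on
    [[0, 1]]. *)
Lemma moment_ibp (psi dpsi kappa : R -> R) i m : (0 < m)%N ->
  (forall t : R, t \in `]0, 1[ -> is_derive t 1 psi (dpsi t)) ->
  (forall t : R, t \in `]0, 1[ -> is_derive t 1 dpsi (kappa t / phi t)) ->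
  admissible psi -> admissible kappa ->
  admissible (fun t => t * (1 - t) * dpsi t) ->
  moment i m kappa = convex_moment i m psi.
Proof.
move=> m0 dpsiE ddpsiE psia kappaa wa.
pose F t := 1 * (t ^+ i * (1 - t) ^+ m.+1 * (t * (1 - t) * dpsi t)) + -1 * (p1 i m t * psi t).
pose r t := 1 * (t ^+ i * (1 - t) ^+ m * kappa t) + -1 * (p2 i m t * psi t).
have FE : F = (fun t => t ^+ i.+1 * (1 - t) ^+ m.+2 * dpsi t - p1 i m t * psi t).
  by apply/funext => t; rewrite /F !exprS; ring.
have := @FTC_within F r 0 1 ltr01.
have kc : {within `[0, 1], continuous (fun t => t ^+ i * (1 - t) ^+ m * kappa t)}.
  by case: (m) m0 => // m' _; exact: admissible_within.
have -> : \int[mu]_(t in `[0, 1]) r t =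
    moment i m kappa - (convex_moment i m psi - (i == 0)%:R * psi 0).
  have I2 : mu.-integrable `[0, 1] (EFin \o (fun t => p2 i m t * psi t)).
    by apply: continuous_compact_integrable; [exact: segment_compact|exact: p2_within].
  have [_ ->] := Rintegral_lin 1 (-1) (moment_integrable i kappaa m0) I2.
  by rewrite p2_integral// /moment -/mu; ring.
have -> : F 1 - F 0 = (i == 0)%:R * psi 0.
  rewrite /F /p1 !subrr subr0 !exprS !mul0r !expr1n expr0n; case: eqP => [->|_] /=; rewrite ?mulr1n ?mulr0n; ring.
have H x y z : (x - (y - z) = z :> R) -> x = y by move=> E; lra.
move=> E; apply: (H _ _ ((i == 0)%:R * psi 0)); apply: E.
- apply: within_lin; last exact: p1_within.
  exact: (@admissible_within _ (fun t => t * (1 - t) * dpsi t)).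
- by apply: within_lin => //; exact: p2_within.
- move=> t t01; rewrite FE.
  have d1 := is_deriveM (dp i m t) (ddpsiE t t01).
  have d2 := is_deriveM (dp1 i m t) (dpsiE t t01).
  apply: (@is_derive_eq _ _ _ _ _ _ _ _ (is_deriveB d1 d2)).
  have /andP[t0 t1] : 0 < t < 1 by move: t01; rewrite in_itv.
  have t0' : t != 0 by rewrite gt_eqF.
  have t1' : 1 - t != 0 by rewrite subr_eq0 gt_eqF.
  rewrite /GRing.scale/= /r /phi !exprS expr0 mulr1.
  move: ((1 - t) ^+ m) (t ^+ i) (p1 i m t) (p2 i m t) => u v w z.
  by field; rewrite t0' t1'.
Qed.

Lemma admissible_continuous f : continuous f -> admissible f.
Proof.
move=> fc; split => [x _||]; first exact: fc.
- by apply: cvg_at_right_filter; exact: fc.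
- apply: (@cvg_toE _ _ _ _ ((1 - 1) * f 1)); last by rewrite subrr mul0r.
  apply: cvg_at_left_filter; apply: cvgM; last exact: fc.
  by apply: cvgB; [exact: cvg_cst|exact: cvg_id].
Qed.

(** The case [kappa = 0] of [moment_ibp]. *)
Lemma convex_moment_affine i m (a b c : R) : (0 < m)%N ->
  convex_moment i m (fun t => a + b * (t - c)) = 0.
Proof.
move=> m0; have mom0 : moment i m (cst (0 : R)) = 0.
  rewrite -[RHS](mul0r (fine (mu `[0, 1]%classic))) -Rintegral_cst//.
  by apply: eq_Rintegral => t _; rewrite mulr0.
rewrite -[RHS]mom0.
apply/esym; apply: (@moment_ibp _ (cst b) (cst 0) i m m0).
- move=> t _; have d : is_derive t 1 (fun t : R => t - c) (1 - 0) by exact: is_deriveB.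
  have := is_deriveD (is_derive_cst a t 1) (is_deriveZ b d).
  by move=> H; apply: (is_derive_eq H); rewrite /GRing.scale/=; ring.
- by move=> t _; rewrite mul0r; exact: is_derive_cst.
- apply: admissible_continuous => t; apply: cvgD; first exact: cvg_cst.
  by apply: cvgM; [exact: cvg_cst|apply: cvgB; [exact: cvg_id|exact: cvg_cst]].
- exact: admissible_cst.
- apply: admissible_continuous => t; apply: cvgM; last exact: cvg_cst.
  by apply: cvgM; [exact: cvg_id|apply: cvgB; [exact: cvg_cst|exact: cvg_id]].
Qed.

(* [p1] changes sign once, at [c], from + to -. Subtracting from [psi] its
   tangent at [c] makes [p1 * psi^`()] nonpositive, so that the derivative of
   [p1 * psi] is at most [p2 * psi]. *)
Lemma convex_moment_ge0 (psi dpsi : R -> R) i m : (0 < m)%N ->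
  (forall t : R, t \in `]0, 1[ -> is_derive t 1 psi (dpsi t)) ->
  {in `]0, 1[ &, nondecreasing_fun dpsi} -> admissible psi ->
  0 <= convex_moment i m psi.
Proof.
move=> m0 dpsiE nd psia.
have s0 : 0 < m%:R + i%:R + 3 :> R by rewrite ltr_wpDl// addr_ge0.
pose c : R := i.+1%:R / (m%:R + i%:R + 3).
have c01 : c \in `]0, 1[.
  rewrite in_itv/= /c divr_gt0//= ltr_pdivrMr// mul1r -natr1.
  have : 0 <= m%:R :> R by []. lra.
pose l t := psi c + dpsi c * (t - c).
have la : admissible l.
  apply: admissible_continuous => t; apply: cvgD; first exact: cvg_cst.
  by apply: cvgM; [exact: cvg_cst|apply: cvgB; [exact: cvg_id|exact: cvg_cst]].
pose f t := 1 * psi t + -1 * l t.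
have fa : admissible f by exact: admissible_lin.
have <- : convex_moment i m f = convex_moment i m psi.
  by rewrite /f convex_moment_lin// convex_moment_affine// mulr0 addr0 mul1r.
have df (t : R) : t \in `]0, 1[ -> is_derive t 1 f (dpsi t - dpsi c).
  move=> t01; have d : is_derive t 1 (fun t : R => t - c) (1 - 0) by exact: is_deriveB.
  have dl := is_deriveD (is_derive_cst (psi c) t 1) (is_deriveZ (dpsi c) d).
  have H := is_deriveD (is_deriveZ 1 (dpsiE t t01)) (is_deriveZ (-1) dl).
  by apply: (is_derive_eq H); rewrite /GRing.scale/=; ring.
have := @derive_le_Rintegral (fun t => p1 i m t * f t)
  (fun t => p1 i m t * (dpsi t - dpsi c) + f t * p2 i m t)
  (fun t => p2 i m t * f t) 0 1 ltr01 (@p1_within _ _ _ fa) (@p2_within _ _ _ m0 fa).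
rewrite p2_integral// => H.
have {}H : p1 i m 1 * f 1 - p1 i m 0 * f 0 <= convex_moment i m f - (i == 0)%:R * f 0.
  apply: H => [t t01|t t01]; first exact: (is_deriveM (dp1 i m t) (df t t01)).
  have /andP[t0 t1] : 0 < t < 1 by move: t01; rewrite in_itv.
  suff : p1 i m t * (dpsi t - dpsi c) <= 0 by rewrite (mulrC (f t)); lra.
  have -> : p1 i m t = (m%:R + i%:R + 3) * (t ^+ i * (1 - t) ^+ m.+1) * (c - t).
    rewrite /p1 /c !exprS -!natr1; have : m%:R + i%:R + 3 != 0 :> R by rewrite gt_eqF.
    by move: ((1 - t) ^+ m) (t ^+ i) => u v *; field.
  have q0 : 0 <= (m%:R + i%:R + 3) * (t ^+ i * (1 - t) ^+ m.+1).
    by rewrite !mulr_ge0 ?exprn_ge0 ?subr_ge0// ltW.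
  rewrite -mulrA; apply: mulr_ge0_le0 => //.
  have [tc|/ltW ct] := leP t c.
    by rewrite mulr_ge0_le0 ?subr_ge0// subr_le0 nd.
  by rewrite mulr_le0_ge0 ?subr_le0// subr_ge0 nd.
(* [p1] vanishes at 1, and at 0 it is 1 or 0 according to whether [i = 0]: the boundary value
   cancels the term [f 0]. *)
move: H; rewrite /p1 !subrr subr0 !exprS !mul0r !expr1n expr0n.
by case: eqP => [->|_] /=; rewrite ?mulr1n ?mulr0n; lra.
Qed.

(** The three values of [unk] in the second difference are moments with one common exponent of
    [1 - t]. For [k = 0] the lowest of them is [f 0] instead, which accounts for the boundary term
    of [convex_moment]. *)
Lemma udelta_unk f n k : (1 < n)%N -> admissible f ->
  udelta n (fun k => unk n k f) k.+1 =
  n%:R * 'C(n + k, k)%:R * convex_moment k n.-1 f.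
Proof.
case: n => // n n1 fa; rewrite /udelta /convex_moment !unkE// -[k.+1.-1]/k -![n.+1.-1]/n.
have E j : 'C(n.+1 + j.+1, j.+1)%:R = (n.+1%:R + j%:R + 1) / (j%:R + 1) * 'C(n.+1 + j, j)%:R :> R.
  have c1 : j%:R + 1 != 0 :> R by rewrite natr1 pnatr_eq0.
  apply: (mulfI c1); rewrite mulrA mulrCA divff// mulr1 natr1 -natrD natr1 -!natrM.
  by congr (_%:R); rewrite addnS -mul_bin_diag.
case: k => [|k].
  rewrite -[unk _ 0 f]/(f 0) -[0.-1]/0%N E addn0 bin0 /= -!natr1.
  by move: (moment 1 n f) (moment 0 n f) (f 0) => u v w; field.
rewrite unkE// -[n.+1.-1]/n -[k.+1.-1]/k !E -!natr1 eqE/= mul0r addr0.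
have h1 : k%:R + 1 != 0 :> R by rewrite natr1 pnatr_eq0.
have h2 : k%:R + 1 + 1 != 0 :> R by rewrite !natr1 pnatr_eq0.
have h3 : n%:R + 1 + k%:R + 1 != 0 :> R by rewrite natr1 -natrD natr1 pnatr_eq0.
move: (moment _ _ _) (moment _ _ _) (moment _ _ _) ('C(_, _)%:R : R) => u v w z.
by field; rewrite h1 h2.
Qed.

End IntegrationByParts.

(** * The comparison function *)

Section Comparison.
Context {R : realType}.
Implicit Types (f g : R -> R) (n k : nat).

Lemma udelta_unk_ibp (psi dpsi kappa : R -> R) n : (1 < n)%N -> kappa 0 = 0 ->
  (forall t : R, t \in `]0, 1[ -> is_derive t 1 psi (dpsi t)) ->
  (forall t : R, t \in `]0, 1[ -> is_derive t 1 dpsi (kappa t / phi t)) ->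
  admissible psi -> admissible kappa ->
  admissible (fun t => t * (1 - t) * dpsi t) ->
  udelta n (fun k => unk n k psi) = fun k => unk n k kappa.
Proof.
move=> n1 kappa0 d1 d2 psia kappaa wa; apply/funext => -[|k].
  by rewrite /udelta mul0r /= kappa0.
rewrite udelta_unk// unkE//; congr (_ * _); apply/esym.
by apply: (@moment_ibp R psi dpsi kappa) => //; case: n n1.
Qed.

Definition xlogit (t : R) : R := t * (ln t - ln (1 - t)).

Definition dxlogit (t : R) : R := ln t - ln (1 - t) + (1 - t)^-1.

Lemma is_derive_ln1B (t : R) : t < 1 ->
  is_derive t 1 (fun t : R => ln (1 - t)) (- (1 - t)^-1).
Proof.
move=> t1; have d : is_derive t 1 (fun t : R => 1 - t) (0 - 1) by exact: is_deriveB.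
have H : is_derive (1 - t) 1 (@ln R) ((1 - t)^-1).
  by apply: is_derive1_ln; rewrite subr_gt0.
have := @is_derive1_comp _ (@ln R) (fun t : R => 1 - t) t _ _ H d.
by move=> H'; apply: (is_derive_eq H'); rewrite /GRing.scale/=; ring.
Qed.

Lemma is_derive_logit (t : R) : t \in `]0, 1[ ->
  is_derive t 1 (fun t : R => ln t - ln (1 - t)) (t^-1 + (1 - t)^-1).
Proof.
rewrite in_itv/= => /andP[t0 t1].
have := is_deriveB (is_derive1_ln t0) (is_derive_ln1B t1).
by move=> H; apply: (is_derive_eq H); rewrite opprK.
Qed.

Lemma is_derive_xlogit (t : R) : t \in `]0, 1[ -> is_derive t 1 xlogit (dxlogit t).
Proof.
move=> t01; have := is_deriveM (is_derive_id t 1) (is_derive_logit t01).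
move=> H; apply: (is_derive_eq H); rewrite /GRing.scale/= /dxlogit.
move: t01; rewrite in_itv/= => /andP[t0 t1]; field.
by rewrite subr_eq0 !gt_eqF.
Qed.

Lemma is_derive_dxlogit (t : R) : t \in `]0, 1[ ->
  is_derive t 1 dxlogit (phi t)^-1.
Proof.
move=> t01; have /andP[t0 t1] : 0 < t < 1 by move: t01; rewrite in_itv.
have t10 : 1 - t != 0 by rewrite subr_eq0 gt_eqF.
have d : is_derive t 1 (fun t : R => 1 - t) (0 - 1) by exact: is_deriveB.
have dV : is_derive t 1 (fun t : R => (1 - t)^-1) (- (1 - t) ^- 2 *: (0 - 1)).
  exact: (@is_deriveV R (fun t : R => 1 - t) t _ 1 t10 d).
have := is_deriveD (is_derive_logit t01) dV.
move=> H; apply: (is_derive_eq H); rewrite /GRing.scale/= /phi; field.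
by rewrite t10 gt_eqF.
Qed.

(** From [ln s <= s - 1] at [s = (Num.sqrt t)^-1]. *)
Lemma norm_xlnx_le (t : R) : 0 < t -> t < 1 -> `|t * ln t| <= 2 * Num.sqrt t.
Proof.
move=> t0 t1; have s0 : 0 < Num.sqrt t by rewrite sqrtr_gt0.
have sE : Num.sqrt t ^+ 2 = t by rewrite sqr_sqrtr// ltW.
rewrite normrM gtr0_norm// ler0_norm; last by rewrite ln_le0// ltW.
have lnE : ln t = - (2 * ln (Num.sqrt t)^-1).
  by rewrite lnV ?posrE// mulrN opprK -{1}sE expr2 lnM ?posrE//; ring.
have : ln (Num.sqrt t)^-1 <= (Num.sqrt t)^-1 - 1.
  have := @le_ln1Dx R ((Num.sqrt t)^-1 - 1); rewrite subrKC; apply.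
  have si : 0 < (Num.sqrt t)^-1 by rewrite invr_gt0.
  lra.
move=> le; rewrite lnE opprK -[X in X * _]sE.
move: (Num.sqrt t) (ln (Num.sqrt t)^-1) s0 le => s l s0 le.
have : s ^+ 2 * (2 * l) <= s ^+ 2 * (2 * (s^-1 - 1)).
  by rewrite ler_wpM2l ?sqr_ge0// ler_wpM2l.
move/le_trans; apply.
rewrite (_ : _ * _ = 2 * s - 2 * s ^+ 2); last by field; rewrite gt_eqF.
by rewrite gerBl mulr_ge0// sqr_ge0.
Qed.

Lemma cvg_xlnx (T : Type) (F : set_system T) (FF : Filter F) (g : T -> R) :
  (\forall t \near F, 0 < g t < 1) -> g @ F --> (0 : R) ->
  g t * ln (g t) @[t --> F] --> (0 : R).
Proof.
move=> g01 g0; apply: norm_cvg0.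
have H : 2 * Num.sqrt (g t) @[t --> F] --> (0 : R).
  apply: (@cvg_toE _ _ _ _ (2 * Num.sqrt 0)); last by rewrite sqrtr0 mulr0.
  apply: cvgM; first exact: cvg_cst.
  by apply: continuous_cvg g0; exact: sqrt_continuous.
apply: (squeeze_cvgr _ (cvg_cst (0 : R)) H).
by apply: filterS g01 => t /andP[t0 t1]; rewrite normr_ge0/= norm_xlnx_le.
Qed.

Lemma cvg_ln1B_at0 : ln (1 - t) @[t --> (0 : R)^'+] --> (0 : R).
Proof.
apply: cvg_at_right_filter.
apply: (@cvg_toE _ _ _ _ (ln (1 - 0))); last by rewrite subr0 ln1.
have [/derivable1_diffP/differentiable_continuous H _] := is_derive_ln1B (@ltr01 R).
exact: H.
Qed.

Lemma cvg_onem_at1 : 1 - t @[t --> (1 : R)^'-] --> (0 : R).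
Proof.
apply: (@cvg_toE _ _ _ _ (1 - 1)); last by rewrite subrr.
by apply: cvg_at_left_filter; apply: cvgB; [exact: cvg_cst|exact: cvg_id].
Qed.

Lemma cvg_xlogit1 : (1 - t) * xlogit t @[t --> (1 : R)^'-] --> (0 : R).
Proof.
rewrite (_ : (fun t => _) = fun t => t * ((1 - t) * ln t - (1 - t) * ln (1 - t))); last first.
  by apply/funext => t; rewrite /xlogit; ring.
apply: (@cvg_toE _ _ _ _ (1 * (0 * ln 1 - 0))); last by rewrite mul0r subrr mulr0.
apply: cvgM; first exact: cvg_at_left_filter.
apply: cvgB.
  apply: cvgM; first exact: cvg_onem_at1.
  apply: cvg_at_left_filter.
  by apply: continuous_ln.
apply: cvg_xlnx; last exact: cvg_onem_at1.
near=> t; rewrite subr_gt0 gtrBl; apply/andP; split.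
  by near: t; exact: nbhs_left_lt.
by near: t; exact: nbhs_left_gt.
Unshelve. all: by end_near. Qed.

Lemma admissible_xlogit : admissible xlogit.
Proof.
split; last exact: cvg_xlogit1.
- move=> t /is_derive_xlogit[d _].
  by apply: differentiable_continuous; exact/derivable1_diffP.
- rewrite /xlogit mul0r.
  rewrite (_ : (fun t => _) = fun t : R => t * ln t - t * ln (1 - t)); last first.
    by apply/funext => t; ring.
  apply: (@cvg_toE _ _ _ _ (0 - 0 * 0)); last by rewrite mulr0 subrr.
  apply: cvgB.
    apply: cvg_xlnx; last exact: cvg_at_right_filter.
    near=> t; apply/andP; split; first by near: t; exact: nbhs_right_gt.
    by near: t; exact: nbhs_right_lt.
  by apply: cvgM; [exact: cvg_at_right_filter|exact: cvg_ln1B_at0].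
Unshelve. all: by end_near. Qed.

Lemma admissible_eq f g : {in `[0, 1[, f =1 g} -> admissible f -> admissible g.
Proof.
move=> fg [fc f0 f1]; split.
- move=> t t01; rewrite /continuous_at -fg; last exact: subset_itv_oo_co t01.
  apply: (cvg_trans _ (fc t t01)). apply: near_eq_cvg.
  apply: filterS (near_in_itvoo t01) => s s01; apply: fg.
  exact: subset_itv_oo_co s01.
- rewrite -fg; last by rewrite in_itv/= lexx ltr01.
  apply: (cvg_trans _ f0); apply: near_eq_cvg.
  near=> t; apply: fg; rewrite in_itv/=; apply/andP; split.
    by rewrite ltW//; near: t; exact: nbhs_right_gt.
  by near: t; exact: nbhs_right_lt.
- apply: (cvg_trans _ f1); apply: near_eq_cvg; near=> t; congr (_ * _).
  apply: fg; rewrite in_itv/=; apply/andP; split; last by near: t; exact: nbhs_left_lt.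
  by rewrite ltW//; near: t; exact: nbhs_left_gt.
Unshelve. all: by end_near. Qed.

Lemma admissible_mul f (p : R -> R) : continuous p -> admissible f ->
  admissible (fun t => p t * f t).
Proof.
move=> pc [fc f0 f1]; split.
- by move=> t t01; apply: cvgM; [exact: pc|exact: fc].
- by apply: cvgM => //; apply: cvg_at_right_filter; exact: pc.
- rewrite (_ : (fun t => _) = fun t => p t * ((1 - t) * f t)); last first.
    by apply/funext => t; ring.
  apply: (@cvg_toE _ _ _ _ (p 1 * 0)); last by rewrite mulr0.
  by apply: cvgM => //; apply: cvg_at_left_filter; exact: pc.
Qed.

Lemma admissible_dxlogit : admissible (fun t => t * (1 - t) * dxlogit t).
Proof.
apply: (@admissible_eq (fun t => 1 * ((1 - t) * xlogit t) + 1 * t)).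
  move=> t; rewrite in_itv/= => /andP[t0 t1]; rewrite /xlogit /dxlogit.
  by field; rewrite subr_eq0 gt_eqF.
apply: admissible_lin; last by apply: admissible_continuous => t; exact: cvg_id.
apply: admissible_mul admissible_xlogit.
by move=> t; apply: cvgB; [exact: cvg_cst|exact: cvg_id].
Qed.

(** Restricted to positive indices: at 0, [udelta] is 0, while [unk n 0] of the constant 1 is 1. *)
Lemma udelta_xlogit n k : (1 < n)%N -> udelta n (fun k => unk n k xlogit) k.+1 = 1.
Proof.
move=> n1; rewrite udelta_unk//; last exact: admissible_xlogit.
rewrite -[RHS](unk_cst k.+1 n1) unkE//; last exact: admissible_cst.
congr (_ * _); apply/esym; apply: (@moment_ibp R xlogit dxlogit (cst 1)).
- by case: n n1.
- exact: is_derive_xlogit.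
- by move=> t t01; rewrite div1r; exact: is_derive_dxlogit.
- exact: admissible_xlogit.
- exact: admissible_cst.
- exact: admissible_dxlogit.
Qed.

(** The bound on increments makes [B * dxlogit + e * dh] nondecreasing for both signs [e], so
    [convex_moment_ge0] applies without a second derivative of [h]. *)
Lemma udelta_bounded (h dh : R -> R) (B : R) n : (1 < n)%N -> 0 <= B ->
  admissible h -> (forall t : R, t \in `]0, 1[ -> is_derive t 1 h (dh t)) ->
  (forall v w : R, 0 < v -> v <= w -> w < 1 ->
    `|dh w - dh v| <= B * (dxlogit w - dxlogit v)) ->
  ubounded B (udelta n (fun k => unk n k h)).
Proof.
move=> n1 B0 ha dhE dhB [|k]; first by rewrite /udelta mul0r normr0.
suff pos (e : R) : `|e| = 1 -> 0 <= B + e * udelta n (fun k => unk n k h) k.+1.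
  rewrite ler_norml; have := pos 1; have := pos (-1).
  by rewrite normrN1 normr1 => /(_ erefl) ? /(_ erefl) ?; apply/andP; split; lra.
move=> e1; have xa := admissible_xlogit.
pose psi t := B * xlogit t + e * h t.
have psia : admissible psi by exact: admissible_lin.
have -> : B + e * udelta n (fun k => unk n k h) k.+1 =
    udelta n (fun k => unk n k psi) k.+1.
  rewrite -[X in X + _](mulr1 B) -[X in B * X](udelta_xlogit k n1) /udelta /psi !unk_lin//.
  by ring.
rewrite udelta_unk// mulr_ge0//.
apply: (@convex_moment_ge0 R psi (fun t => B * dxlogit t + e * dh t)) => //.
- by case: n n1.
- move=> t t01.
  exact: (is_deriveD (is_deriveZ B (is_derive_xlogit t01)) (is_deriveZ e (dhE t t01))).
- move=> v w; rewrite !in_itv/= => /andP[v0 v1] /andP[w0 w1] vw.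
  have : `|e * (dh w - dh v)| <= B * (dxlogit w - dxlogit v).
    by rewrite normrM e1 mul1r; exact: dhB.
  by rewrite ler_norml => /andP[]; lra.
Qed.

End Comparison.

(** * Regularity of the functions of [W2] *)

Section Regularity.
Context {R : realType}.
Let mu : {measure set (measurableTypeR R) -> \bar R} := @lebesgue_measure R.
Implicit Types (f g h : R -> R).

Lemma enorm_ae h (B : R) : (enorm h <= B%:E)%E ->
  {ae mu, forall x, x \in `]0, 1[ -> `|h x| <= B}.
Proof.
rewrite /enorm unlock.
have muT : (0 < (@lebesgue_measure R) [set: R])%E.
  by rewrite -set_itvNyy lebesgue_measure_itv/= addye ?ltry.
rewrite [X in if X then _ else _]muT => /ess_supP; apply: filterS => x /= + x01.
by rewrite patchE mem_set ?lee_fin//=; exact: subset_itv_oo_co x01.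
Qed.

Lemma ae_le_Rintegral (D : set (measurableTypeR R)) f g : measurable D ->
  mu.-integrable D (EFin \o f) -> mu.-integrable D (EFin \o g) ->
  {ae mu, forall x, D x -> f x <= g x} ->
  \int[mu]_(x in D) f x <= \int[mu]_(x in D) g x.
Proof.
move=> mD fi gi fg; rewrite -subr_ge0 -RintegralB//.
have gfi : mu.-integrable D (EFin \o (fun x => g x - f x)) by exact: (integrableB mD gi fi).
have mgf : measurable_fun D (fun x => g x - f x).
  by apply/measurable_EFinP; exact: measurable_int gfi.
rewrite /Rintegral fine_ge0//.
rewrite (@ae_eq_integral _ _ _ mu D (fun x => `|g x - f x|%:E)%E)//.
- by apply: integral_ge0 => x _; rewrite lee_fin.
- by apply/measurable_EFinP.
- by apply/measurable_EFinP; exact: measurableT_comp.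
- by apply: filterS fg => x fgx Dx; rewrite ger0_norm// subr_ge0 fgx.
Qed.

Lemma ACloc_FTC (F : R -> R) (a b : R) : ACloc F -> 0 < a -> a < b -> b < 1 ->
  exists d : R -> R, [/\ mu.-integrable setT (EFin \o d),
    forall x, x \in `[a, b] -> F x - F a = \int[mu]_(t in `[a, x]) d t &
    {ae mu, forall x, x \in `]a, b[ -> derive1 F x = d x}].
Proof.
move=> acF a0 ab b1.
have [d [di FE dE]] := abs_continuous_FTC ab (acF _ _ a0 (ltW ab) b1).
exists d; split => //; apply: (@filterS _ _ (ae_filter_ringOfSetsType mu) _ _ _ dE).
by move=> x H /H[].
Qed.

Lemma phi_gt0 (t : R) : t \in `]0, 1[ -> 0 < phi t.
Proof. by rewrite in_itv/= => /andP[t0 t1]; rewrite /phi mulr_gt0// exprn_gt0// subr_gt0. Qed.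

Lemma continuous_phi : continuous (@phi R).
Proof.
move=> t; rewrite (_ : phi = fun t => t ^+ 1 * (1 - t) ^+ 2); first exact: continuous_monomial.
by apply/funext => x; rewrite /phi expr1.
Qed.

(* [derive1 F] is 0 by convention where [F] is not derivable; there are no such
   points when [phi * derive1 F] is continuous, since [F] is then a primitive of
   a continuous function. *)
Lemma ACloc_is_derive (F kappa : R -> R) : ACloc F ->
  {in `]0, 1[, continuous kappa} ->
  (forall t, phi t * derive1 F t = kappa t) ->
  forall t : R, t \in `]0, 1[ -> is_derive t 1 F (kappa t / phi t).
Proof.
move=> acF kc FE t t01; have /andP[t0 t1] : 0 < t < 1 by move: t01; rewrite in_itv.
pose a := t / 2; pose b := (1 + t) / 2.
have [a0 at_ tb b1] : [/\ 0 < a, a < t, t < b & b < 1] by rewrite /a /b; split; lra.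
have ab := lt_trans at_ tb.
have [d [di FI dE]] := ACloc_FTC acF a0 ab b1.
pose q x := kappa x / phi x.
have sub x : x \in `[a, b] -> x \in `]0, 1[.
  by rewrite !in_itv/= => /andP[ax xb]; rewrite (lt_le_trans a0)// (le_lt_trans xb).
have qc x : x \in `]0, 1[ -> {for x, continuous q}.
  move=> x01; apply: cvgM; first exact: kc.
  by apply: cvgV; [rewrite gt_eqF// phi_gt0|exact: continuous_phi].
have qi : mu.-integrable `[a, b] (EFin \o q).
  apply: continuous_compact_integrable; first exact: segment_compact.
  apply: continuous_in_subspaceT => x /set_mem; exact: (fun xab => qc x (sub x xab)).
have FQ x : x \in `]a, b[ -> F x = F a + \int[mu]_(s in `[a, x]) q s.
  move=> xab; have /andP[ax xb] : a < x < b by move: xab; rewrite in_itv.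
  have -> : F x = F a + (F x - F a) by ring.
  congr (_ + _); rewrite FI; last exact: subset_itv_oo_cc xab.
  have qix : mu.-integrable `]a, x] (EFin \o q).
    apply: integrableS qi => //; apply: subset_itv; rewrite bnd_simp//; exact: ltW.
  have dix : mu.-integrable `]a, x] (EFin \o d) by exact: integrableS di.
  rewrite -Rintegral_itv_obnd_cbnd// -[RHS]Rintegral_itv_obnd_cbnd//.
  rewrite /Rintegral (@ae_eq_integral _ _ _ mu _ (EFin \o q))//.
  - exact: measurable_int dix.
  - exact: measurable_int qix.
  - apply: (@filterS _ _ (ae_filter_ringOfSetsType mu) _ _ _ dE) => s sd /=; rewrite in_itv/= => /andP[as_ sx].
    have sab : s \in `]a, b[ by rewrite in_itv/= as_ (le_lt_trans sx).
    have s01 : s \in `]0, 1[ by apply: sub; exact: subset_itv_oo_cc sab.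
    by rewrite -sd// /q -FE mulrAC divff ?mul1r// gt_eqF// phi_gt0.
have [|dQ Qq] := continuous_FTC1_closed tb qi at_; first exact: qc.
have tab : t \in `]a, b[ by rewrite in_itv/= at_.
have nFQ : \forall y \near t, F y = F a + \int[mu]_(s in `[a, y]) q s.
  by apply: filterS (near_in_itvoo tab) => y; exact: FQ.
have [dF FQE] := derivable_near_addC nFQ dQ.
by apply: DeriveDef => //; rewrite -derive1E FQE.
Qed.

(** An increment of [F] is the integral of its almost everywhere derivative, which is at most
    [B / phi], and [dxlogit] is a primitive of [1 / phi]. *)
Lemma ACloc_dxlogit (F : R -> R) (B : R) : ACloc F ->
  {ae mu, forall x, x \in `]0, 1[ -> `|phi x * derive1 F x| <= B} ->
  forall v w, 0 < v -> v <= w -> w < 1 ->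
    `|F w - F v| <= B * (dxlogit w - dxlogit v).
Proof.
move=> acF FB v w v0; rewrite le_eqVlt => /predU1P[->|vw] w1.
  by rewrite !subrr normr0 mulr0.
have [d [di FI dE]] := ACloc_FTC acF v0 vw w1.
have sub x : x \in `[v, w] -> x \in `]0, 1[.
  by rewrite !in_itv/= => /andP[vx xw]; rewrite (lt_le_trans v0)// (le_lt_trans xw).
have pc : {within `[v, w], continuous (fun x : R => (phi x)^-1)}.
  apply: continuous_in_subspaceT => x /set_mem /sub x01.
  by apply: cvgV; [rewrite gt_eqF// phi_gt0|exact: continuous_phi].
have pi : mu.-integrable `[v, w] (EFin \o (fun x : R => (phi x)^-1)).
  by apply: continuous_compact_integrable => //; exact: segment_compact.
have Epi : \int[mu]_(x in `[v, w]) (phi x)^-1 = dxlogit w - dxlogit v.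
  apply: FTC_within => //.
    apply: continuous_in_subspaceT => x /set_mem /sub /is_derive_dxlogit[dx _].
    by apply: differentiable_continuous; exact/derivable1_diffP.
  by move=> t tvw; apply: is_derive_dxlogit; apply: sub; exact: subset_itv_oo_cc tvw.
have div : mu.-integrable `[v, w] (EFin \o d) by exact: integrableS di.
have sub' x : x \in `]v, w[ -> x \in `]0, 1[.
  by move=> xvw; apply: sub; exact: subset_itv_oo_cc xvw.
have Bpi : mu.-integrable `[v, w] (EFin \o (fun x => B * (phi x)^-1)).
  exact: (integrableZl _ B pi).
have key (e : R) : `|e| = 1 -> e * (F w - F v) <= B * (dxlogit w - dxlogit v).
  move=> e1; rewrite FI ?in_itv/= ?lexx ?andbT; last exact: ltW.
  rewrite -Epi -RintegralZl// -RintegralZl//.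
  have edi : mu.-integrable `[v, w] (EFin \o (fun x => e * d x)).
    exact: (integrableZl _ e div).
  have oo (f : R -> R) : mu.-integrable `[v, w] (EFin \o f) ->
      \int[mu]_(x in `[v, w]) f x = \int[mu]_(x in `]v, w[) f x
      /\ mu.-integrable `]v, w[ (EFin \o f).
    move=> fi; have fi1 : mu.-integrable `]v, w] (EFin \o f).
      by apply: integrableS fi => //; exact: subset_itv_oc_cc.
    have fi2 : mu.-integrable `]v, w[ (EFin \o f).
      by apply: integrableS fi => //; exact: subset_itv_oo_cc.
    by split => //; rewrite -Rintegral_itv_obnd_cbnd// -Rintegral_itv_bndo_bndc.
  have [-> i1] := oo _ edi; have [-> i2] := oo _ Bpi.
  apply: ae_le_Rintegral => //.
  apply: (@filterS2 _ _ (ae_filter_ringOfSetsType mu) _ _ _ _ FB dE).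
  move=> x FBx dx /= xvw; have x01 := sub' _ xvw; have p0 := phi_gt0 x01.
  rewrite ler_pdivlMr// -dx// (le_trans (ler_norm _))//.
  by rewrite -mulrA normrM e1 mul1r mulrC FBx.
rewrite ler_norml; have := key 1; have := key (-1).
by rewrite normrN1 normr1 => /(_ erefl) ? /(_ erefl) ?; apply/andP; split; lra.
Qed.

(** Supplies the boundary condition of [moment_ibp]. The derivative at [t] is compared with the
    slope of [g] over a step proportional to [t (1 - t)]. The error is the step times the supremum
    of [|h| / phi] over it; on such a step [phi] stays comparable to [t (1 - t) ^+ 2], so after
    weighting the error is at most [2 C t]. Near 0 the slope term vanishes since [g] has a limit
    there; near 1 boundedness is enough. *)
Lemma admissible_weighted_derive (g dg h : R -> R) (C G : R) :
  (forall t : R, t \in `]0, 1[ -> is_derive t 1 g (dg t)) ->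
  (forall t : R, t \in `]0, 1[ -> is_derive t 1 dg (h t / phi t)) ->
  {in `]0, 1[, continuous h} ->
  (forall t, t \in `]0, 1[ -> `|h t| <= C) ->
  (forall t, t \in `]0, 1[ -> `|g t| <= G) ->
  g @ 0^'+ --> g 0 ->
  admissible (fun t => t * (1 - t) * dg t).
Proof.
move=> gE dgE hc hC gG g0.
have cont (F dF : R -> R) (t : R) : t \in `]0, 1[ -> 
    (forall t : R, t \in `]0, 1[ -> is_derive t 1 F (dF t)) -> {for t, continuous F}.
  move=> t01 /(_ _ t01)[d _].
  by apply: differentiable_continuous; exact/derivable1_diffP.
have C0 : 0 <= C.
  by apply: le_trans (hC (2^-1) _) => //; rewrite in_itv/=; apply/andP; split; lra.
(* Half of [t (1 - t)], so that [1 - s >= (1 - t) / 2] for all [s] between [t] and [y t]. *)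
pose y (t : R) := t + t * (1 - t) / 2.
have key t : t \in `]0, 1[ ->
    `|t * (1 - t) * dg t| <= 2 * `|g (y t) - g t| + 2 * C * t.
  move=> t01; have /andP[t0 t1] : 0 < t < 1 by move: t01; rewrite in_itv.
  have [d dE] : exists d, d = t * (1 - t) / 2 by exists (t * (1 - t) / 2).
  have d0 : 0 < d by rewrite dE divr_gt0// mulr_gt0// subr_gt0.
  have yt : y t = t + d by rewrite dE.
  have ty : t < y t by rewrite yt ltrDl.
  have dt : d <= (1 - t) / 2.
    by rewrite dE ler_wpM2r// ger_pMl ?subr_gt0// ltW.
  have sub s : s \in `[t, y t] -> s \in `]0, 1[.
    rewrite !in_itv/= yt => /andP[ts sy]; rewrite (lt_le_trans t0)//=.
    lra.
  have ct (F dF : R -> R) : (forall t : R, t \in `]0, 1[ -> is_derive t 1 F (dF t)) ->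
      {within `[t, y t], continuous F}.
    move=> dF'; apply: continuous_in_subspaceT => s /set_mem /sub s01.
    exact: (cont _ _ _ s01 dF').
  have gE' s : s \in `]t, y t[ -> is_derive s 1 g (dg s).
    by move=> st; apply/gE/sub; exact: subset_itv_oo_cc st.
  have [xi xit E1] := MVT ty gE' (ct _ _ gE).
  have /andP[txi xiy] : t < xi < y t by move: xit; rewrite in_itv.
  have dgE' s : s \in `]t, xi[ -> is_derive s 1 dg (h s / phi s).
    move=> st; apply/dgE/sub; move: st; rewrite !in_itv/= => /andP[ts sx].
    by rewrite (ltW ts) (ltW (lt_trans sx xiy)).
  have dgc : {within `[t, xi], continuous dg}.
    apply: continuous_subspaceW (ct dg (fun s => h s / phi s) dgE) => s /=.
    by rewrite !in_itv/= => /andP[-> sx]; rewrite (le_trans sx)// ltW.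
  have [s sxi E2] := MVT txi dgE' dgc.
  have /andP[ts sx] : t < s < xi by move: sxi; rewrite in_itv.
  have s01 : s \in `]0, 1[ by apply: sub; rewrite in_itv/= (ltW ts) (ltW (lt_trans sx xiy)).
  have phis : t * (1 - t) ^+ 2 / 4 <= phi s.
    rewrite /phi (_ : t * (1 - t) ^+ 2 / 4 = t * ((1 - t) / 2) ^+ 2); last by field.
    have t2 : 0 <= (1 - t) / 2 by lra.
    have st2 : (1 - t) / 2 <= 1 - s by move: (lt_trans sx xiy); rewrite yt; lra.
    by rewrite ler_pM ?(ltW t0) ?sqr_ge0 ?(ltW ts)// !expr2 ler_pM.
  have E3 : t * (1 - t) * dg t = 2 * (g (y t) - g t) - 2 * d * (xi - t) * (h s / phi s).
    have -> : dg t = dg xi - h s / phi s * (xi - t) by rewrite -E2; ring.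
    by rewrite E1 yt dE; move: (h s / phi s) => q; field.
  rewrite E3 (le_trans (ler_normB _ _))// normrM ger0_norm// lerD2l.
  have p0 := phi_gt0 s01.
  have xit0 : 0 <= xi - t by lra.
  rewrite !normrM (ger0_norm (ltW d0)) (ger0_norm xit0) normfV (gtr0_norm p0) ger0_norm//.
  have xid : xi - t <= d by move: xiy; rewrite yt; lra.
  apply: (@le_trans _ _ (2 * d * d * (C / phi s))).
    have d20 : 0 <= 2 * d by rewrite mulr_ge0// ltW.
    apply: ler_pM; [exact: mulr_ge0|by rewrite divr_ge0// ltW|exact: ler_wpM2l|].
    by rewrite ler_wpM2r ?invr_ge0 ?(ltW p0)// hC.
  rewrite mulrA ler_pdivrMr//.
  apply: (@le_trans _ _ (2 * C * t * (t * (1 - t) ^+ 2 / 4))).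
    by rewrite dE le_eqVlt; apply/orP; left; apply/eqP; field.
  by rewrite ler_wpM2l// !mulr_ge0// ltW.
have y01 t : t \in `]0, 1[ -> y t \in `]0, 1[.
  rewrite !in_itv/= /y => /andP[t0 t1].
  have : 0 < t * (1 - t) by rewrite mulr_gt0// subr_gt0.
  have : t * (1 - t) <= 1 - t by rewrite ger_pMl ?subr_gt0// ltW.
  by move=> ? ?; apply/andP; split; lra.
apply: (@admissible_bounded _ _ (4 * G + 2 * C)).
- move=> t t01; apply: cvgM; last exact: (cont _ _ _ t01 dgE).
  by apply: cvgM; [exact: cvg_id|apply: cvgB; [exact: cvg_cst|exact: cvg_id]].
- rewrite !mul0r; apply: norm_cvg0.
  have H : 2 * `|g (y t) - g t| + 2 * C * t @[t --> (0 : R)^'+] --> (0 : R).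
    apply: (@cvg_toE _ _ _ _ (2 * `|g 0 - g 0| + 2 * C * 0)); last first.
      by rewrite subrr normr0 !mulr0 addr0.
    apply: cvgD; apply: cvgM; try exact: cvg_cst; last exact: cvg_at_right_filter.
    apply: cvg_norm; apply: cvgB => //.
    apply/cvgrPdist_lt => e e0.
    have /cvgrPdist_lt/(_ _ e0)[r /= r0 ger] := g0.
    near=> t; have t0 : 0 < t by near: t; exact: nbhs_right_gt.
    have t1 : t < 1 by near: t; exact: nbhs_right_lt.
    have tr : t < r / 2 by near: t; apply: nbhs_right_lt; rewrite divr_gt0.
    have y0 : 0 < y t.
      by have := y01 t; rewrite !in_itv/= t0 t1 => /(_ isT) /andP[].
    apply: ger => //=; rewrite sub0r normrN gtr0_norm// /y.
    have : t * (1 - t) <= t by rewrite ler_piMr ?gerBl// ltW.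
    lra.
  apply: (squeeze_cvgr _ (cvg_cst (0 : R)) H); near=> t.
  rewrite normr_ge0/= key// in_itv/=; apply/andP; split.
    by near: t; exact: nbhs_right_gt.
  by near: t; exact: nbhs_right_lt.
- move=> t t0 t1; have t01 : t \in `]0, 1[ by rewrite in_itv/= t0.
  rewrite (le_trans (key _ t01))//.
  have := gG _ t01; have := gG _ (y01 _ t01).
  have : C * t <= C by rewrite ler_piMr// ltW.
  have := ler_normB (g (y t)) (g t); lra.
Unshelve. all: by end_near. Qed.

End Regularity.

(** * Convergence and conclusion *)

Section Convergence.
Context {R : realType}.
Implicit Types (f g : R -> R) (m n k : nat).

Lemma unk_le n k f g : (1 < n)%N -> admissible f -> admissible g ->
  (forall t, 0 <= t -> t < 1 -> f t <= g t) -> unk n k f <= unk n k g.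
Proof.
move=> n1 fa ga fg; case: k => [|k]; first exact: fg.
rewrite -subr_ge0.
have -> : unk n k.+1 g - unk n k.+1 f = unk n k.+1 (fun t => 1 * g t + -1 * f t).
  by rewrite unk_lin//; ring.
rewrite unkE//; last exact: admissible_lin.
rewrite mulr_ge0//; apply: moment_ge0 => t; rewrite in_itv/= => /andP[t0].
rewrite le_eqVlt => /predU1P[->|t1].
  by case: n n1 => [|[|n]]//= _; rewrite subrr exprS mul0r mulr0 mul0r.
rewrite !mulr_ge0 ?exprn_ge0//; first by rewrite subr_ge0 ltW.
by have := fg _ t0 t1; lra.
Qed.

Lemma admissible_shift_square (x : R) : admissible (fun t => (t - x) ^+ 2).
Proof.
apply: admissible_continuous => t; rewrite (_ : (fun t => _) = fun t => (t - x) * (t - x)).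
  by apply: cvgM; apply: cvgB; try exact: cvg_id; exact: cvg_cst.
by apply/funext => s; rewrite expr2.
Qed.

Lemma moment_const_rec j n : moment j.+1 n (cst 1 : R -> R) =
  j.+1%:R / (j%:R + n%:R + 2) * moment j n (cst 1).
Proof.
rewrite !moment1 addSn !factS !natrM -!natr1 natrD.
have h (i : nat) : i`!%:R != 0 :> R by rewrite pnatr_eq0 -lt0n fact_gt0.
have h1 : j%:R + n%:R + 1 != 0 :> R by rewrite -natrD natr1 pnatr_eq0.
have h2 : j%:R + n%:R + 2 != 0 :> R by rewrite -!natrD pnatr_eq0 addn2.
have h3 : j%:R + n%:R + 1 + 1 != 0 :> R by rewrite -natrD !natr1 pnatr_eq0.
move: (h (j + n)%N); move: (j`!%:R : R) (n`!%:R : R) ((j + n)`!%:R : R) => p q r r0.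
by field; rewrite h1 h2 r0.
Qed.

(** For [k >= 1], [unk n k] is the expectation under the Beta law with parameters [k] and [n]: the
    mean is [k / (n + k)] and the variance is at most [1 / n]. For [k = 0] it is the point mass at
    0. *)
Lemma unk_shift_square n k (x : R) : (1 < n)%N ->
  unk n k (fun t => (t - x) ^+ 2) <=
  (k%:R * (1 - x) - n%:R * x) ^+ 2 / n%:R ^+ 2 + n%:R^-1.
Proof.
move=> n1; have n0 : 0 < n%:R :> R by rewrite ltr0n (ltn_trans _ n1).
case: k => [|k].
  rewrite [leLHS](_ : _ = (0 * (1 - x) - n%:R * x) ^+ 2 / n%:R ^+ 2).
    by rewrite lerDl invr_ge0 ltW.
  by rewrite /=; field; rewrite gt_eqF.
have -> : unk n k.+1 (fun t => (t - x) ^+ 2) =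
    (k%:R + 1) / (n%:R + k%:R + 1) * ((k%:R + 2) / (n%:R + k%:R + 2))
    - 2 * x * ((k%:R + 1) / (n%:R + k%:R + 1)) + x ^+ 2.
  rewrite unkE//; last exact: admissible_shift_square.
  have M i : moment i n.-1 (fun t => t * t) = moment i.+2 n.-1 (cst 1 : R -> R).
    by apply: eq_Rintegral => t _; rewrite !exprS /=; ring.
  have M' i : moment i n.-1 id = moment i.+1 n.-1 (cst 1 : R -> R).
    by apply: eq_Rintegral => t _; rewrite !exprS /=; ring.
  have n'0 : (0 < n.-1)%N by case: (n) n1.
  have c1 := admissible_cst (1 : R).
  have ida : admissible (id : R -> R) by apply: admissible_continuous => t; exact: cvg_id.
  have sqa : admissible (fun t : R => t * t).
    by apply: admissible_continuous => t; apply: cvgM; exact: cvg_id.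
  have -> : (fun t => (t - x) ^+ 2) =
     (fun t => 1 * (1 * (t * t) + (- (2 * x)) * id t) + x ^+ 2 * cst 1 t).
    by apply/funext => t /=; ring.
  rewrite moment_lin//; last exact: admissible_lin.
  rewrite moment_lin// M M' !moment_const_rec.
  have := @unk_cst R n k.+1 n1; rewrite unkE// => U.
  have nE : n.-1%:R = n%:R - 1 :> R by case: (n) n1 => // m _; rewrite -natr1 addrK.
  have h1 : n%:R + k%:R + 1 != 0 :> R by rewrite -natrD natr1 pnatr_eq0.
  have h2 : n%:R + k%:R + 2 != 0 :> R by rewrite -!natrD pnatr_eq0 addn2.
  rewrite nE -!natr1.
  have h3 : k%:R + (n%:R - 1) + 2 != 0 :> R.
    by rewrite (_ : _ + 2 = n%:R + k%:R + 1) //; ring.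
  have h4 : k%:R + 1 + (n%:R - 1) + 2 != 0 :> R.
    by rewrite (_ : _ + 2 = n%:R + k%:R + 2) //; ring.
  (* The factor [U], the value 1 at the constant 1, lets the normalisation and the moment remain
     unevaluated on both sides. *)
  rewrite -[RHS]mulr1 -[X in _ = _ * X]U.
  move: (n%:R * _) (moment _ _ _) => u v.
  by field; rewrite ?h1 ?h2 ?h3 ?h4.
rewrite -[k.+1%:R](natr1 k); have : 0 <= k%:R :> R by [].
have n2 : 2 <= n%:R :> R by rewrite ler_nat.
move: (k%:R) (n%:R) n0 n2 => q r r0 r2 q0.
rewrite [leLHS](_ : _ = ((q + 1) * (1 - x) - r * x) ^+ 2 / (r + q + 1) ^+ 2
    + r^-1 * (r * (q + 1) * r / ((r + q + 1) ^+ 2 * (r + q + 2)))); last first.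
  by field; apply/and3P; split; apply/eqP; lra.
apply: lerD.
  rewrite ler_wpM2l ?sqr_ge0// lef_pV2 ?posrE ?exprn_gt0//; last by lra.
  by rewrite !expr2 ler_pM//; lra.
rewrite ler_piMr ?invr_ge0 ?(ltW r0)// ler_pdivrMr; last first.
  by rewrite mulr_gt0 ?exprn_gt0//; lra.
rewrite mul1r -subr_ge0.
rewrite (_ : _ - _ = (q + 1) * (q + 1) * (q + 1) + (q + 1) * (q + 1) + r * (q + 1) * (3 * (q + 1) + 2) + r * r * (2 * (q + 1) + 1) + r * r * r); last by ring.
by rewrite !addr_ge0// !mulr_ge0//; lra.
Qed.

Lemma Pnk_deviation_sum n (x : R) : 0 < x -> x < 1 ->
  series (fun k => (k%:R * (1 - x) - n%:R * x) ^+ 2 * Pnk n k x) @ \oo -->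
  (x ^+ 2 * (n%:R + 2) + (n%:R + 1) * x * (1 - x) : R).
Proof.
move=> x0 x1; have y0 : 1 - x != 0 by rewrite subr_eq0 gt_eqF.
have := @Pnk_quartic_sum R n x (n%:R ^+ 2 * x ^+ 2)
  ((1 - x) ^+ 2 - 2 * (1 - x) * n%:R * x) ((1 - x) ^+ 2) 0 0 (ltW x0) x1.
rewrite (_ : (fun k => _) = fun k => (k%:R * (1 - x) - n%:R * x) ^+ 2 * Pnk n k x).
  by move=> H; apply: (cvg_toE H); rewrite -natr1; field.
by apply/funext => k /=; ring.
Qed.

(** Chebyshev's argument: [|g t - g x|] is at most [e / 2] near [x] and at most [K (t - x) ^+ 2]
    elsewhere, and the positive operator [T_m] sends [(t - x) ^+ 2] to at most [3 / m] at [x]: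
    [1 / m] from the Beta variance, [2 / m] from the negative binomial one. *)
Lemma PnkT_unk_cvg g (G x : R) : 0 < x -> x < 1 -> admissible g ->
  (forall t, 0 <= t -> t < 1 -> `|g t| <= G) ->
  (fun m => PnkT m (fun k => unk m k g) x) @ \oo --> g x.
Proof.
move=> x0 x1 ga gG.
have G0 : 0 <= G by exact: le_trans (gG x (ltW x0) x1).
apply/cvgrPdist_le => e e0.
have gx : {for x, continuous g} by case: ga => + _ _; apply; rewrite in_itv/= x0.
have e20 : 0 < e / 2 by rewrite divr_gt0.
have /cvgrPdist_le/(_ _ e20)/nbhs_ballP[d /= d0 gd] := gx.
pose K := 2 * G / d ^+ 2.
have K0 : 0 <= K by rewrite divr_ge0 ?sqr_ge0// mulr_ge0.
have dom t : 0 <= t -> t < 1 -> `|g t - g x| <= e / 2 + K * (t - x) ^+ 2.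
  move=> t0 t1; have [td|dt] := ltP `|x - t| d.
    by rewrite distrC (le_trans (gd _ td))// lerDl mulr_ge0// sqr_ge0.
  rewrite (le_trans (ler_normB _ _))// (@le_trans _ _ (2 * G))//.
    by have := gG _ t0 t1; have := gG _ (ltW x0) x1; lra.
  rewrite (@le_trans _ _ (K * (t - x) ^+ 2))//; last by rewrite lerDr ltW.
  rewrite /K mulrAC ler_pdivlMr ?exprn_gt0// ler_wpM2l ?mulr_ge0//.
  rewrite -(real_normK (num_real (t - x))) distrC !expr2 ler_pM// ltW//.
clearbody K.
near=> m.
have m1 : (1 < m)%N by near: m; exact: nbhs_infty_gt.
have m0 : 0 < m%:R :> R by rewrite ltr0n (ltn_trans _ m1).
have Km : K * (3 / m%:R) <= e / 2.
  rewrite mulrA ler_pdivrMr// [leRHS]mulrC -ler_pdivrMr//; near: m.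
  exact: nbhs_infty_ger.
have c1 := admissible_cst (1 : R).
have sqa := admissible_shift_square x.
have [Ub Ub'] := (unk_bounded m1 ga gG, unk_bounded m1 c1 (M := 1)).
pose f t := 1 * g t + (- g x) * cst 1 t.
have fa : admissible f by exact: admissible_lin.
pose F t := (e / 2) * cst 1 t + K * (t - x) ^+ 2.
have Fa : admissible F by exact: admissible_lin.
have b1 : ubounded 1 (fun k => unk m k (cst 1 : R -> R)).
  by move=> k; rewrite unk_cst// normr1.
have fE : PnkT m (fun k => unk m k f) x = PnkT m (fun k => unk m k g) x - g x.
  rewrite (_ : (fun k => unk m k f) = fun k => 1 * unk m k g + (- g x) * unk m k (cst 1)).
    rewrite (PnkT_lin x0 x1 m _ _ Ub b1) mul1r mulNr; congr (_ - _).
    rewrite -[RHS]mulr1; congr (_ * _); rewrite /PnkT.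
    apply: (cvg_lim (@Rhausdorff R)); rewrite (_ : (fun k => _) = Pnk m ^~ x).
      exact: Pnk_sum (ltW x0) x1.
    by apply/funext => k; rewrite unk_cst// mul1r.
  by apply/funext => k; rewrite unk_lin.
have fF t : 0 <= t -> t < 1 -> `|f t| <= F t.
  by move=> t0 t1; rewrite /f /F /= mul1r !mulr1 dom.
pose b k := (e / 2 + K / m%:R) * (1 * Pnk m k x)
  + K / m%:R ^+ 2 * ((k%:R * (1 - x) - m%:R * x) ^+ 2 * Pnk m k x).
have fb k : `|unk m k f * Pnk m k x| <= b k.
  have P0 : 0 <= Pnk m k x by apply: Pnk_ge0 => //; exact: ltW.
  rewrite normrM (ger0_norm P0).
  have -> : b k = (e / 2 + K * ((k%:R * (1 - x) - m%:R * x) ^+ 2 / m%:R ^+ 2 + m%:R^-1)) * Pnk m k x.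
    by rewrite /b; field; rewrite gt_eqF.
  rewrite ler_wpM2r// (@le_trans _ _ (unk m k F))//.
    have Nfa : admissible (fun t => -1 * f t + 0 * f t) by exact: admissible_lin.
    rewrite ler_norml; apply/andP; split; last first.
      by apply: unk_le => // t t0 t1; rewrite (le_trans (ler_norm _)) ?fF.
    rewrite lerNl (_ : - _ = unk m k (fun t => -1 * f t + 0 * f t)); last first.
      by rewrite (@unk_lin R m k f f (-1) 0 m1 fa fa); ring.
    apply: unk_le => // t t0 t1; rewrite mul0r addr0 mulN1r.
    by rewrite (le_trans (ler_norm _))// normrN fF.
  rewrite /F unk_lin// unk_cst// mulr1 lerD2l ler_wpM2l//.
  exact: unk_shift_square.
have S1 : series (fun k => 1 * Pnk m k x) @ \oo --> (1 : R).
  rewrite (_ : (fun k => _) = Pnk m ^~ x); first exact: Pnk_sum (ltW x0) x1.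
  by apply/funext => k; rewrite mul1r.
have bs := @cvg_series_lin R _ _ _ _ (e / 2 + K / m%:R) (K / m%:R ^+ 2) S1 (@Pnk_deviation_sum m x x0 x1).
have [_] := dominated_series fb bs.
rewrite -/(PnkT m _ x) fE distrC => /le_trans; apply.
rewrite mulr1 [leRHS]splitr -addrA lerD2l (le_trans _ Km)//.
rewrite (_ : K * (3 / m%:R) = K / m%:R + K / m%:R ^+ 2 * (2 * m%:R)); last first.
  by field; rewrite gt_eqF.
rewrite lerD2l ler_wpM2l ?divr_ge0 ?sqr_ge0//.
have m2 : 2 <= m%:R :> R by rewrite ler_nat.
nra.
Unshelve. all: by end_near. Qed.

End Convergence.

(** * The estimates for the operator *)

Section Operator.
Context {R : realType}.
Let mu : {measure set (measurableTypeR R) -> \bar R} := @lebesgue_measure R.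
Implicit Types (f g h : R -> R) (m n k : nat).

Lemma Mtn_cvg n f (M x : R) : (1 < n)%N -> 0 < x -> x < 1 -> admissible f ->
  (forall t, 0 <= t -> t < 1 -> `|f t| <= M) ->
  cvgn (series (fun k => unk n k f * Ptnk n k x)) /\
  `|Mtn n f x| <= Num.sqrt 6 * M.
Proof.
move=> n1 x0 x1 fa fM; have Ub := unk_bounded n1 fa fM.
have M0 : 0 <= M by exact: le_trans (Ub 0%N).
pose a k := `|Ptnk n k x|.
have aN N : series a N <= Num.sqrt 6.
  by rewrite /series/= big_mkord; exact: Ptnk_abs_sum.
have nd : nondecreasing_seq (series a).
  by apply: nondecreasing_series => k _ _; exact: normr_ge0.
have ca : cvgn (series a).
  by apply: nondecreasing_is_cvgn => //; exists (Num.sqrt 6) => _ [N _ <-].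
have la : limn (series a) <= Num.sqrt 6 by apply: limr_le => //; near=> N; exact: aN.
have Z : series (fun=> 0 : R) @ \oo --> (0 : R).
  rewrite (_ : series _ = cst 0); first exact: cvg_cst.
  by apply/funext => N; rewrite /series/= big1.
have [] := @dominated_series R (fun k => unk n k f * Ptnk n k x)
   (fun k => M * a k + 0 * 0) _ _ (@cvg_series_lin R _ _ _ _ M 0 ca Z).
  by move=> k; rewrite mul0r addr0 normrM ler_wpM2r//; exact: Ub.
move=> cf lf; split => //; rewrite (le_trans lf)// mul0r addr0 mulrC.
by rewrite ler_wpM2r.
Unshelve. all: by end_near. Qed.

Lemma Mtn_lin n f g (a b Mf Mg x : R) : (1 < n)%N -> 0 < x -> x < 1 ->
  admissible f -> (forall t, 0 <= t -> t < 1 -> `|f t| <= Mf) ->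
  admissible g -> (forall t, 0 <= t -> t < 1 -> `|g t| <= Mg) ->
  Mtn n (fun t => a * f t + b * g t) x = a * Mtn n f x + b * Mtn n g x.
Proof.
move=> n1 x0 x1 fa fM ga gM.
have [cf _] := Mtn_cvg n1 x0 x1 fa fM; have [cg _] := Mtn_cvg n1 x0 x1 ga gM.
rewrite [LHS]/Mtn; apply: (cvg_lim (@Rhausdorff R)).
rewrite (_ : (fun k => _) = fun k => a * (unk n k f * Ptnk n k x) + b * (unk n k g * Ptnk n k x)).
  exact: (@cvg_series_lin R _ _ _ _ a b cf cg).
by apply/funext => k; rewrite unk_lin//; ring.
Qed.

(** The estimates divide by [x], so 0 is treated apart; there [phi] vanishes and [Ptnk] reduces to
    [Pnk]. *)
Lemma Mtn0 n f : Mtn n f 0 = f 0.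
Proof.
have P k : Ptnk n k (0 : R) = (k == 0)%:R.
  rewrite /Ptnk /Dt /phi !mul0r mulr0 subr0 /Pnk subr0 expr1n mulr1.
  by case: k => [|k]; rewrite ?addn0 ?bin0 ?expr0 ?mulr1// exprS mul0r mulr0.
apply: (cvg_lim (@Rhausdorff R)); rewrite -cvg_shiftS.
rewrite (_ : (fun N => _) = cst (f 0)); first exact: cvg_cst.
apply/funext => N; rewrite /series/= big_nat_recl//= P eqxx mulr1 big1 ?addr0//.
by move=> k _; rewrite P mulr0.
Qed.

(** Turns the essential bound on [h] into the pointwise one that [unk_bounded] asks for. *)
Lemma continuous_ae_le h (C : R) : {in `]0, 1[, continuous h} ->
  {ae mu, forall x, x \in `]0, 1[ -> `|h x| <= C} ->
  forall x, x \in `]0, 1[ -> `|h x| <= C.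
Proof.
move=> hc [N [mN N0 hN]] x x01; rewrite leNgt; apply/negP => Chx.
have /nbhs_ballP[e /= e0 eN] : \forall y \near x, N y.
  have nh : \forall y \near x, C < `|h y|.
    exact: (cvgr_gt (`|h x|) (cvg_norm (hc _ x01))).
  near=> y; apply: hN => /= H.
  have y01 : y \in `]0, 1[ by near: y; exact: near_in_itvoo.
  have : C < `|h y| by near: y.
  by rewrite ltNge H.
have : (mu (ball x e) <= mu N)%E by rewrite le_measure ?inE//; exact: measurable_ball.
rewrite N0 [X in (X <= _)%E]lebesgue_measure_ball ?(ltW e0)// lee_fin.
by rewrite leNgt pmulrn_lgt0// e0.
Unshelve. all: by end_near. Qed.

Lemma enorm_fin_num h : (enorm h < +oo)%E -> exists2 B : R, 0 <= B & enorm h = B%:E.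
Proof.
move=> hoo; have h0 : (0 <= enorm h)%E by exact: Lnorm_ge0.
have hf : enorm h \is a fin_num by rewrite ge0_fin_numE.
by exists (fine (enorm h)); [exact: fine_ge0|rewrite fineK].
Qed.

Lemma is_derive_derive1 h : {in `]0, 1[, forall x : R, derivable h x 1} ->
  forall t : R, t \in `]0, 1[ -> is_derive t 1 h (derive1 h t).
Proof. by move=> dh t /dh dht; apply: DeriveDef => //; rewrite derive1E. Qed.

Lemma Mtn_smooth n g (G B x : R) : (1 < n)%N -> 0 < x -> x < 1 -> 0 <= B ->
  W2 g -> W2 (Dt g) -> (forall t, 0 <= t -> t < 1 -> `|g t| <= G) ->
  enorm (Dt (Dt g)) = B%:E -> `|Mtn n g x - g x| <= B / n%:R ^+ 2.
Proof.
move=> n1 x0 x1 B0 [dg acg acdg [_ hoo] g0] [dh ach acdh _ h0] gG hB.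
set h := Dt g in hoo dh ach acdh h0 hB.
have cont (F : R -> R) : {in `]0, 1[, forall x : R, derivable F x 1} -> {in `]0, 1[, continuous F}.
  by move=> dF t /dF dFt; apply: differentiable_continuous; exact/derivable1_diffP.
have [C C0 hC] := enorm_fin_num hoo.
have hc := cont _ dh.
have hb : forall t, t \in `]0, 1[ -> `|h t| <= C.
  by apply: continuous_ae_le => //; apply: enorm_ae; rewrite hC.
have h00 : h 0 = 0 by rewrite /h /Dt /phi !mul0r.
have hb' t : 0 <= t -> t < 1 -> `|h t| <= C.
  rewrite le_eqVlt => /predU1P[<- _|t0 t1]; first by rewrite h00 normr0.
  by apply: hb; rewrite in_itv/= t0.
have gb t : t \in `]0, 1[ -> `|g t| <= G.
  by rewrite in_itv/= => /andP[t0 t1]; rewrite gG// ltW.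
have gE := is_derive_derive1 dg.
(* By definition [Dt g t] is [phi t] times the derivative of [derive1 g], so continuity of [h] makes
   [derive1 g] differentiable throughout the open interval. *)
have dgE := @ACloc_is_derive R (derive1 g) h acdg hc (fun=> erefl).
have ga : admissible g.
  apply: (@admissible_bounded R g G) => //; first exact: cont.
  by move=> t t0 t1; rewrite gG// ltW.
have ha : admissible h.
  by apply: (@admissible_bounded R h C) => // t t0 t1; rewrite hb' // ltW.
have wa := admissible_weighted_derive gE dgE hc hb gb g0.
have hE := is_derive_derive1 dh.
have hBle : (enorm (Dt h) <= B%:E)%E by rewrite hB.
have dhB := ACloc_dxlogit acdh (enorm_ae hBle).
have dU m : (n <= m)%N -> udelta m (fun k => unk m k g) = fun k => unk m k h.
  by move=> nm; apply: (udelta_unk_ibp (leq_trans n1 nm) h00 gE dgE).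
have Ub m : (n <= m)%N -> ubounded G (fun k => unk m k g).
  by move=> nm; apply: (unk_bounded (leq_trans n1 nm)).
have Vb m : (n <= m)%N -> ubounded C (fun k => unk m k h).
  by move=> nm; apply: (unk_bounded (leq_trans n1 nm)).
have := @telescoping_bound R x n (fun m k => unk m k g) (fun m k => unk m k h) G C B (g x)
  x0 x1 (ltnW n1).
have -> : PnkT n (fun k => unk n k g) x - n%:R^-1 * PnkT n (fun k => unk n k h) x = Mtn n g x.
  apply/esym/(cvg_lim (@Rhausdorff R)).
  have [c1 _] := PnkT_cvg x0 x1 n (Ub n (leqnn n)).
  have c2 : series (fun k => unk n k g * Dt (Pnk n k) x) @ \oo --> PnkT n (fun k => unk n k h) x.
    rewrite -(dU n (leqnn n)); apply: (PnkT_Dt x0 x1 (Ub n (leqnn n)) (M' := C)).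
    by rewrite dU//; exact: Vb.
  have := @cvg_series_lin R _ _ _ _ 1 (- n%:R^-1) c1 c2.
  rewrite mul1r mulNr (_ : (fun k => _) = fun k => unk n k g * Ptnk n k x)//.
  by apply/funext => k; rewrite /Ptnk; ring.
apply => //.
- by move=> m nm; apply: unext_unk => //; exact: leq_trans nm.
- by move=> m nm; apply: unext_unk => //; exact: leq_trans nm.
- move=> m nm; apply: (udelta_bounded (leq_trans n1 nm) B0 ha hE) => v w v0 vw w1.
  exact: dhB.
- exact: PnkT_unk_cvg x0 x1 ga gG.
Qed.

Lemma within_co_admissible f (M : R) : {within `[0, 1[, continuous f} ->
  {in `[0, 1[, forall x, `|f x| <= M} -> admissible f.
Proof.
move=> fc fM.
have W b : 0 < b -> b < 1 -> {within `[0, b], continuous f}.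
  move=> b0 b1; apply: continuous_subspaceW fc.
  by apply: subset_itv; rewrite bnd_simp.
apply: (@admissible_bounded R f M).
- move=> t; rewrite in_itv/= => /andP[t0 t1].
  have := W ((1 + t) / 2); case/(_ _ _)/continuous_within_itvP; try lra.
  by move=> + _ _; apply; rewrite in_itv/= t0; lra.
- have := W 2^-1; case/(_ _ _)/continuous_within_itvP; try lra.
  by [].
- by move=> t t0 t1; apply: fM; rewrite in_itv/= t1 ltW.
Qed.

End Operator.

Theorem theorem1p1 (R : realType) (n : nat) (f : R -> R) :
  (2 <= n)%N ->
  {within `[0, 1[, continuous f} ->
  (exists M : R, {in `[0, 1[, forall x, `|f x| <= M}) ->
  (unorm (Mtn n f \- f)%R <= (Num.sqrt 6 + 1)%R%:E * Kfun f (n%:R ^- 2)%R)%E.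
Proof.
move=> n1 fc [M fM].
have fa := within_co_admissible fc fM.
have s6 : 0 <= Num.sqrt 6 :> R by exact: sqrtr_ge0.
have c0 : 0 < Num.sqrt 6 + 1 :> R by rewrite ltr_wpDl.
have t0 : 0 < n%:R ^- 2 :> R by rewrite invr_gt0 exprn_gt0// ltr0n (ltn_trans _ n1).
rewrite -lee_pdivrMl//; apply: le_ereal_inf_tmp => _ [g [[Wg _] WDg] <-].
rewrite lee_pdivrMl//.
have [_ _ _ [_ DDoo] _] := WDg.
have [B B0 hB] := enorm_fin_num DDoo.
rewrite hB -EFinM.
have fg0 : (0 <= unorm (f \- g)%R)%E.
  apply: le_trans (ereal_sup_ubound _); last first.
    by exists 0 => //=; rewrite in_itv/= lexx ltr01.
  by rewrite lee_fin.
(* An infinite distance makes the right-hand side infinite; a finite one makes [g] bounded, by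
   [M + D]. *)
have [fgoo|fgoo] := eqVneq (unorm (f \- g)%R) +oo%E.
  by rewrite fgoo addye// gt0_muley ?lte_fin// leey.
have fgfin : unorm (f \- g)%R \is a fin_num by rewrite ge0_fin_numE// lt_neqAle fgoo leey.
rewrite -(fineK fgfin) -EFinD -EFinM; set D := fine _.
have fgD t : 0 <= t -> t < 1 -> `|f t - g t| <= D.
  move=> t00 t1; rewrite -lee_fin /D fineK//; apply: ereal_sup_ubound.
  by exists t => //=; rewrite in_itv/= t00.
have fM' t : 0 <= t -> t < 1 -> `|f t| <= M by move=> ? ?; apply: fM; rewrite in_itv/=; apply/andP.
have gG t : 0 <= t -> t < 1 -> `|g t| <= M + D.
  move=> t00 t1; have -> : g t = f t - (f t - g t) by ring.
  by rewrite (le_trans (ler_normB _ _))// lerD ?fM' ?fgD.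
have D0 : 0 <= D by exact: fine_ge0.
have ga : admissible g.
  case: Wg => dg _ _ _ g0; apply: (@admissible_bounded R g (M + D)) => //.
    by move=> t /dg dgt; apply: differentiable_continuous; exact/derivable1_diffP.
  by move=> t t00 t1; apply: gG => //; exact: ltW.
apply: ub_ereal_sup => _ [x /= + <-]; rewrite in_itv/= lee_fin => /andP[x0 x1].
have rhs0 : 0 <= (Num.sqrt 6 + 1) * (D + n%:R ^- 2 * B).
  by rewrite mulr_ge0 ?(ltW c0)// addr_ge0// mulr_ge0// ltW.
move: x0; rewrite le_eqVlt => /predU1P[<-|x0].
  by rewrite Mtn0 subrr normr0.
have dfa : admissible (fun t => 1 * f t + -1 * g t) by exact: admissible_lin.
have dfD t : 0 <= t -> t < 1 -> `|1 * f t + -1 * g t| <= D.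
  by move=> t00 t1; rewrite mul1r mulN1r fgD.
have E1 := Mtn_lin 1 (-1) n1 x0 x1 fa fM' ga gG.
have [_ E2] := Mtn_cvg n1 x0 x1 dfa dfD.
have E3 := Mtn_smooth n1 x0 x1 B0 Wg WDg gG hB.
have E4 := fgD _ (ltW x0) x1.
rewrite E1 in E2.
(* The three parts are at most [Num.sqrt 6 * D], [B / n ^ 2] and [D]; the common factor
   [Num.sqrt 6 + 1] comes from the first and the last. *)
have -> : Mtn n f x - f x = (1 * Mtn n f x + -1 * Mtn n g x) + (Mtn n g x - g x) - (f x - g x).
  by ring.
rewrite (le_trans (ler_normB _ _))//.
have := ler_normD (1 * Mtn n f x + -1 * Mtn n g x) (Mtn n g x - g x).
have : 0 <= Num.sqrt 6 * (n%:R ^- 2 * B) by rewrite !mulr_ge0// ltW.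
rewrite mulrC in E3.
move: E2 E3 E4; move: `|_ + _| `|_| `|_| `|_| => a b c d; lra.
Qed.
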